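(* Let $T$ be a semistandard tableau (with positive integer entries, of some shape $\zeta=(\zeta_1\ge\cdots\ge\zeta_k)$ given by its column lengths). Then the right key of $T$ equals the scanning tableau of $T$: $$R(T)=S(T).$$
   Context: Shapes and tableaux. A shape is a sequence $\zeta=(\zeta_1,\dots,\zeta_k)$ of positive integers with $\zeta_1\ge\cdots\ge\zeta_k$, $k\ge 0$; its Young diagram has $\zeta_i$ top-justified boxes in column $i$. A (semistandard) tableau of shape $\zeta$ is a filling of this diagram with positive integers, strictly increasing down columns and weakly increasing (left to right) along rows. $T_i$ denotes the $i$th column of $T$. For a single entry $x$ and a column $C$, $x\bigodot C$ is the column obtained by attaching $x$ to the bottom of $C$. For a column $C$ and a tableau $U$, $C\bigoplus U$ is obtained by prepending $C$ to the left side of $U$. For a set $d$ of boxes, $T\setminus d$ is the result of removing those boxes and their entries; $T\setminus T_1$ is $T$ with its first column removed. Scanning tableau $S(T)$. The earliest weakly increasing subsequence (EWIS) of a sequence $(x_1,x_2,\dots)$ is $(x_{i_1},x_{i_2},\dots)$ where $i_1=1$ and for $j>1$, $i_j$ is the smallest index after $i_{j-1}$ with $x_{i_j}\ge x_{i_{j-1}}$ (the subsequence stops when there is no such index). Let $b_i$ be the bottom entry of $T_i$, let $e=(e_1,\dots,e_m)$ be the EWIS of $b=(b_1,\dots,b_k)$, and let $d=\{d_1,\dots,d_m\}$ be the set of boxes containing the entries of $e$ (bottom boxes of the corresponding columns); $T\setminus d$ is again a tableau. Define recursively: $S_{1B}(T):=e_m$ if $T$ is nonempty (and empty if $T$ is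 empty); $S_1(T):=S_{1B}(T)\bigodot S_1(T\setminus d)$ (empty column if $T$ is empty); $S(T):=S_1(T)\bigoplus S(T\setminus T_1)$ (empty if $T$ is empty). Right key $R(T)$. For shapes $\zeta$ and $\eta$ with $\eta$ contained in $\zeta$, the skew diagram $\zeta\setminus\eta$ is obtained by removing the diagram of $\eta$ from that of $\zeta$ (some column lengths may be zero). A skew tableau is a filling of a skew diagram with positive integers strictly increasing down columns and weakly increasing along rows. The rectification of a skew tableau is the (well-defined) tableau obtained by successively applying jeu de taquin slides to inside corners until none are left. A skew tableau is frank if its column lengths are a rearrangement of the column lengths of its rectification. For $T$ of shape $\zeta$ with $k$ columns and $1\le i\le k$, $R_i(T)$ is the rightmost column of any frank skew tableau that rectifies to $T$ and whose rightmost column has length $\zeta_i$ (it is known that this depends only on $T$ and $\zeta_i$). The right key of $T$ is $R(T):=\bigoplus_{i=1}^k R_i(T)$, i.e. the tableau of shape $\zeta$ whose $i$th column is $R_i(T)$. *)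

(* Defs.v *)
From mathcomp Require Import all_boot.
From mathcomp Require Import boolp classical_sets.

Set Implicit Arguments.
Unset Strict Implicit.
Unset Printing Implicit Defensive.

(* Diagrams are stored as lists of columns, each listed from top to bottom;
   the box (c, r) is the one in column c and row r, both counted from 0. *)

Definition is_shape (zeta : seq nat) : bool :=
  all (leq 1) zeta && sorted geq zeta.

Definition is_tableau (zeta : seq nat) (T : seq (seq nat)) : Prop :=
  [/\ is_shape zeta,
      map size T = zeta,
      all (all (leq 1)) T,
      all (sorted ltn) T &
      forall c r, r < size (nth [::] T c.+1) ->
        nth 0 (nth [::] T c) r <= nth 0 (nth [::] T c.+1) r].

Definition drop_bottom {A : Type} (C : seq A) : seq A := take (size C).-1 C.

Definition drop_empty {A : Type} (U : seq (seq A)) : seq (seq A) :=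
  [seq C <- U | 0 < size C].

(* Selects the earliest weakly increasing subsequence: m is the last selected
   value, and m = 0 at the start forces the first term to be selected. *)
Fixpoint ewis_mask (m : nat) (b : seq nat) : bitseq :=
  if b is x :: b' then
    if m <= x then true :: ewis_mask x b' else false :: ewis_mask m b'
  else [::].

Definition ewis (b : seq nat) : seq nat := mask (ewis_mask 0 b) b.

Definition bottoms (T : seq (seq nat)) : seq nat := [seq last 0 C | C <- T].

Definition remove_ewis (T : seq (seq nat)) : seq (seq nat) :=
  drop_empty [seq (if p.1 then drop_bottom p.2 else p.2)
             | p <- zip (ewis_mask 0 (bottoms T)) T].

(* The fuel n bounds the number of recursive calls. *)
Fixpoint scan_col_rec (n : nat) (T : seq (seq nat)) : seq nat :=
  if n is n'.+1 then
    if nilp T then [::]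
    else rcons (scan_col_rec n' (remove_ewis T)) (last 0 (ewis (bottoms T)))
  else [::].

Definition boxes (T : seq (seq nat)) : nat := sumn (map size T).

Definition scan_col (T : seq (seq nat)) : seq nat := scan_col_rec (boxes T) T.

Fixpoint scanning (T : seq (seq nat)) : seq (seq nat) :=
  if T is _ :: T' then scan_col T :: scanning T' else [::].

(* The fuel never runs out: scan_col satisfies its defining recursion. *)

Lemma ewis_mask_size m b : size (ewis_mask m b) = size b.
Proof. by elim: b m => //= x b IH m; case: ifP => _ /=; rewrite IH. Qed.

Lemma boxes_drop_empty T : boxes (drop_empty T) = boxes T.
Proof. by rewrite /boxes; elim: T => //= -[|x C] T IH //=; rewrite IH. Qed.

Lemma drop_empty_nonempty T : all (fun C : seq nat => C != [::]) (drop_empty T).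
Proof. by elim: T => //= -[|x C] T IH. Qed.

Lemma boxes_remove_ewis T :
  all (fun C => C != [::]) T -> T != [::] -> boxes (remove_ewis T) < boxes T.
Proof.
rewrite /remove_ewis boxes_drop_empty; case: T => //= -[//|x C] T _ _ /=.
rewrite /boxes /= /drop_bottom size_take /= leqnn addSn ltnS leq_add2l.
move: (last x C) => m; elim: T m => //= D T IH m.
case: ifP => _ /=; apply: leq_add => //.
by rewrite /drop_bottom size_take; case: ifP => // _; exact: leq_pred.
Qed.

Lemma scan_col_nil : scan_col [::] = [::].
Proof. by []. Qed.

Lemma scan_col_rcons T :
  all (fun C => C != [::]) T -> T != [::] ->
  scan_col T = rcons (scan_col (remove_ewis T)) (last 0 (ewis (bottoms T))).
Proof.
have fuel n : forall T', all (fun C => C != [::]) T' -> boxes T' <= n ->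
    scan_col_rec n T' = scan_col T'.
  elim/ltn_ind: n => n IH T' T'0; rewrite leq_eqVlt => /orP[/eqP<- //|lt_n].
  case: n IH lt_n => // n IH lt_n; have [-> //|T'N] := eqVneq T' [::].
  have lt_T' := boxes_remove_ewis T'0 T'N.
  have ne := drop_empty_nonempty
    [seq (if p.1 then drop_bottom p.2 else p.2)
    | p <- zip (ewis_mask 0 (bottoms T')) T'].
  rewrite /scan_col; case: (boxes T') lt_T' lt_n => // k lt_k lt_n /=.
  case: ifP => // _; rewrite !IH //; first exact: ltnW.
  by rewrite -ltnS; apply: leq_trans lt_k (ltnW _).
move=> T0 TN; have lt_T := boxes_remove_ewis T0 TN.
rewrite {1}/scan_col; case: (boxes T) lt_T => // k lt_k /=.
rewrite (negbTE (_ : ~~ nilp T)); last by case: T TN {T0 lt_k}.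
by rewrite fuel // drop_empty_nonempty.
Qed.

(* A skew tableau of shape zeta \ eta is stored on the whole diagram of zeta,
   with None in the boxes of eta. *)

Definition entry (U : seq (seq (option nat))) (c r : nat) : option nat :=
  nth None (nth [::] U c) r.

Definition set_entry (U : seq (seq (option nat))) (c r : nat) (x : option nat) :
    seq (seq (option nat)) :=
  set_nth [::] U c (set_nth None (nth [::] U c) r x).

Definition is_skew_tableau (zeta eta : seq nat) (U : seq (seq (option nat))) :
    Prop :=
  [/\ [/\ is_shape zeta, is_shape eta &
          forall c, nth 0 eta c <= nth 0 zeta c],
      map size U = zeta,
      forall c r, isSome (entry U c r) = (nth 0 eta c <= r < nth 0 zeta c),
      forall c r x, entry U c r = Some x -> 0 < x &
      (forall c r x y,
         entry U c r = Some x -> entry U c r.+1 = Some y -> x < y) /\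
      (forall c r x y,
         entry U c r = Some x -> entry U c.+1 r = Some y -> x <= y)].

Definition inner_box (U : seq (seq (option nat))) (c r : nat) : bool :=
  (r < size (nth [::] U c)) && (entry U c r == None).

Definition inside_corner (U : seq (seq (option nat))) (c r : nat) : bool :=
  [&& inner_box U c r, ~~ inner_box U c r.+1 & ~~ inner_box U c.+1 r].

(* slide c r U V: starting from U with a hole in box (c, r), the jeu de taquin
   slide ends in V. The neighbour below wins ties; a hole with no neighbour
   below or to the right is removed from the outer shape. *)
Inductive slide : nat -> nat -> seq (seq (option nat)) ->
    seq (seq (option nat)) -> Prop :=
| slide_stop c r U :
    entry U c r.+1 = None -> entry U c.+1 r = None ->
    slide c r U
      (drop_empty (set_nth [::] U c (drop_bottom (nth [::] U c))))
| slide_down c r U V b :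
    entry U c r.+1 = Some b ->
    (forall a, entry U c.+1 r = Some a -> b <= a) ->
    slide c r.+1 (set_entry (set_entry U c r (Some b)) c r.+1 None) V ->
    slide c r U V
| slide_right c r U V a :
    entry U c.+1 r = Some a ->
    (forall b, entry U c r.+1 = Some b -> a < b) ->
    slide c.+1 r (set_entry (set_entry U c r (Some a)) c.+1 r None) V ->
    slide c r U V.

Inductive rectifies_to :
    seq (seq (option nat)) -> seq (seq nat) -> Prop :=
| rectified T : rectifies_to [seq map Some C | C <- T] T
| rectify_slide U V T c r :
    inside_corner U c r -> slide c r U V -> rectifies_to V T ->
    rectifies_to U T.

Definition column_lengths (U : seq (seq (option nat))) : seq nat :=
  [seq count isSome C | C <- U].

Definition column_entries (C : seq (option nat)) : seq nat := pmap id C.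

(* U is a frank skew tableau with rectification T. *)
Definition frank_rectifies_to (U : seq (seq (option nat))) (T : seq (seq nat)) :
    Prop :=
  [/\ exists zeta eta, is_skew_tableau zeta eta U,
      rectifies_to U T &
      perm_eq (column_lengths U) (map size T)].

Definition frank_right_column (T : seq (seq nat)) (l : nat) (C : seq nat) :
    Prop :=
  size C = l /\
  exists2 U, frank_rectifies_to U T & column_entries (last [::] U) = C.

(* The unique rightmost column of length l of the frank skew tableaux
   rectifying to T. The default [::] is returned if there is no such column or
   more than one; it is never a column of a tableau. *)
Definition right_key_col (T : seq (seq nat)) (l : nat) : seq nat :=
  xget [::] [set C | forall D, frank_right_column T l D <-> D = C].

Definition right_key (T : seq (seq nat)) : seq (seq nat) :=
  [seq right_key_col T (size C) | C <- T].

(* Main.v *)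
Require Import Defs.
From mathcomp Require Import all_boot.
From mathcomp Require Import boolp classical_sets zify.

(** A sequence of columns with distinct entries is a 0/1 matrix, whose entry
    (c, x) tells whether column c contains the letter x.  Two families of
    crystal operators act on such matrices: a column operator moves one letter
    from column c+1 to column c, and a row operator turns one letter a+1 into
    a.  Both act at the place given by the usual bracketing rule, which is
    phrased here as an extremum of the difference of two counting functions.

    Each horizontal move of a jeu de taquin hole is a column operator
    ([holed_right]), and vertical moves leave the contents of all columns
    unchanged.  Hence a skew tableau and its rectification are [linked], that
    is, related by a zigzag of column operators ([rectifies_linked]).  A
    tableau is a matrix on which no column operator is defined.

    The two families commute ([raise_lift_diamond]).  So a sequence of row
    operators that turns a tableau T into a matrix Y on which no operator of
    either kind is defined can be replayed on every matrix linked to T, and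
    its results stay linked to Y.  The columns of Y are initial segments of
    the letters, column operators preserve the number of occurrences of each
    letter, row operators preserve the column lengths, and row operators are
    injective.  Two uniqueness results follow.  A tableau linked to T equals T
    ([col_highest_linked_eq]).  And a 0/1 matrix whose row sums are those of Y
    and whose column lengths are a rearrangement of those of Y is unique once
    the order of the lengths is given ([extremal_below]), so the same holds
    for the matrices linked to T with rearranged column lengths
    ([extremal_linked_eq]).  Since column operators on the other columns can
    sort these by length, the last column of such a matrix depends only on its
    own length ([extremal_last_col]); this is why the right key is well
    defined.

    It remains to find, for each column of T, one frank skew tableau that ends
    in the corresponding column of the scanning tableau.  Performed one column
    at a time instead of one pass at a time, scanning is a left fold
    ([scan_col_foldl]) whose step [swap_right A C] goes up the column A and
    replaces each entry that is at most the lowest unused entry of C by that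
    entry.  The bracketing rule shows that [swap_left A C], [swap_right A C]
    are what A, C become when column operators exchange their lengths
    ([linked_swap]).  Moving a column of T to the far right by such exchanges
    yields columns linked to T.  Placed on a staircase, without contact between
    different columns, they form a frank skew tableau; its rectification is a
    tableau linked to T, hence T. *)

Set Implicit Arguments.
Unset Strict Implicit.
Unset Printing Implicit Defensive.

Local Notation incidence := (nat -> nat -> bool).

(** * Bracketing through counting functions *)

Fixpoint below (p : pred nat) (n : nat) : nat :=
  if n is m.+1 then below p m + p m else 0.

Lemma leq_below p m n : m <= n -> below p m <= below p n.
Proof. by move=> /subnK <-; elim: (n - m) => //= k; lia. Qed.

Lemma below_leq p n : below p n <= n.
Proof. by elim: n => //= n; case: (p n); lia. Qed.

Lemma eq_below_beyond p m n :
  (forall i, m <= i -> ~~ p i) -> m <= n -> below p n = below p m.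
Proof.
move=> p0 /subnK <-; elim: (n - m) => //= k.
by rewrite (negbTE (p0 _ _)) ?addn0 // leq_addl.
Qed.

(** Read the letters in increasing order, a letter of f as an opening bracket
    and a letter of g as a closing one: p is the last unmatched closing
    bracket.  Equivalently p + 1 is the first point at which the excess of
    closing over opening brackets is maximal. *)
Definition raises_at (f g : pred nat) (p : nat) : Prop :=
  (forall q, q <= p -> below g q + below f p.+1 < below g p.+1 + below f q) /\
  (forall q, p < q -> below g q + below f p.+1 <= below g p.+1 + below f q).

(** The same bracketing with the roles exchanged: f closes, g opens, and d is
    the first unmatched opening bracket, that is, the last point at which the
    excess of f over g is maximal. *)
Definition lifts_at (f g : pred nat) (d : nat) : Prop :=
  (forall e, e <= d -> below f e + below g d <= below f d + below g e) /\
  (forall e, d < e -> below f e + below g d < below f d + below g e).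

(** * Column and row operators *)

Definition col_move (c p : nat) (M : incidence) : incidence :=
  fun c' x => if x == p then (c' == c) || (c' != c.+1) && M c' x else M c' x.

Definition row_move (a d : nat) (M : incidence) : incidence :=
  fun c x => if c == d then (x == a) || (x != a.+1) && M c x else M c x.

Lemma raises_at_mem f g p : raises_at f g p -> g p /\ f p = false.
Proof. by case=> /(_ p (leqnn p)) /= + _; case: (g p); case: (f p); lia. Qed.

Lemma lifts_at_mem f g d : lifts_at f g d -> g d /\ f d = false.
Proof. by case=> _ /(_ d.+1 (leqnn _)) /=; case: (g d); case: (f d); lia. Qed.

Lemma raises_at_uniq f g p q : raises_at f g p -> raises_at f g q -> p = q.
Proof.
by move=> [lp gp] [lq gq]; case: (ltngtP p q) => // lt;
  [move: (lq p.+1 lt) (gp q.+1 (leqW lt)) | move: (lp q.+1 lt) (gq p.+1 (leqW lt))]; lia.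
Qed.

Lemma lifts_at_uniq f g p q : lifts_at f g p -> lifts_at f g q -> p = q.
Proof.
by move=> [lp gp] [lq gq]; case: (ltngtP p q) => // lt;
  [move: (lq p (ltnW lt)) (gp q lt) | move: (lp q (ltnW lt)) (gq p lt)]; lia.
Qed.

(** The excess is constant from N on, so it has a maximum; a positive maximum
    is not attained at 0. *)
Lemma raises_at_exists f g N :
  (forall x, N <= x -> ~~ f x) -> (forall x, N <= x -> ~~ g x) ->
  (exists q, below f q < below g q) -> exists p, raises_at f g p.
Proof.
move=> f0 g0 [q0 lt_q0].
have cap q : exists2 r, r <= N & below f q = below f r /\ below g q = below g r.
  case: (leqP q N) => [le_q|/ltnW le_q]; first by exists q.
  by exists N => //; split; apply: eq_below_beyond.
have [r0 le_r0 [ef eg]] := cap q0; move: lt_q0; rewrite ef eg => lt_r0.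
(* Shifted by N to make the truncated subtraction exact. *)
pose F r := N + below g r - below f r.
have leF r : below f r <= N + below g r.
  have [r' le_r' [-> _]] := cap r; have := below_leq f r'; lia.
have exF : exists m, [exists r : 'I_N.+1, F r == m].
  by exists (F r0); apply/existsP; exists (Ordinal (n:=N.+1) (m:=r0) le_r0).
have ubF m : [exists r : 'I_N.+1, F r == m] -> m <= N + N.
  move=> /existsP[[r lt_r] /= /eqP<-]; have := below_leq g r; rewrite /F; lia.
case: (ex_maxnP exF ubF) => m /existsP[[r1 lt_r1] /= /eqP eq_m] maxm.
have maxF q : F q <= m.
  have [r le_r [e1 e2]] := cap q; rewrite /F e1 e2; apply: maxm.
  by apply/existsP; exists (Ordinal (n:=N.+1) (m:=r) le_r).
have exr : exists r, F r == m by exists r1; rewrite eq_m.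
case: (ex_minnP exr) => -[|p] /eqP eqp minp.
  by have := maxF r0; rewrite -eqp /F /=; lia.
exists p; split=> q hq.
  have := maxF q; have := leF q; have := leF p.+1.
  have : F q <> m by move=> eq; have := minp q; rewrite eq eqxx; lia.
  rewrite -eqp /F; lia.
by have := maxF q; have := leF q; have := leF p.+1; rewrite -eqp /F; lia.
Qed.

(** A maximum that exceeds the final value of the excess is last attained at
    a point before K. *)
Lemma lifts_at_exists f g K :
  (forall x, K <= x -> ~~ f x) -> (forall x, K <= x -> ~~ g x) ->
  (exists d, below f K + below g d < below f d + below g K) ->
  exists d, lifts_at f g d.
Proof.
move=> f0 g0 [q0 lt_q0].
have cap q : exists2 r, r <= K & [/\ below f q = below f r, below g q = below g r & r <= q].
  case: (leqP q K) => [le_q|/ltnW le_q]; first by exists q.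
  by exists K => //; split => //; apply: eq_below_beyond.
(* Shifted by K to make the truncated subtraction exact. *)
pose F r := K + below f r - below g r.
have leF r : below g r <= K + below f r.
  have [r' le_r' [_ -> _]] := cap r; have := below_leq g r'; lia.
have exF : exists m, [exists r : 'I_K.+1, F r == m].
  by exists (F 0); apply/existsP; exists (@ord0 K).
have ubF m : [exists r : 'I_K.+1, F r == m] -> m <= K + K.
  move=> /existsP[[r lt_r] /= /eqP<-]; have := below_leq f r; rewrite /F; lia.
case: (ex_maxnP exF ubF) => m /existsP[[r1 lt_r1] /= /eqP eq_m] maxm.
have maxF q : F q <= m.
  have [r le_r [e1 e2 _]] := cap q; rewrite /F e1 e2; apply: maxm.
  by apply/existsP; exists (Ordinal (n:=K.+1) (m:=r) le_r).
have neK : F K <> m.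
  by have := maxF q0; have := leF K; have := leF q0; rewrite /F; lia.
have exr : exists r, (r <= K) && (F r == m).
  by exists r1; rewrite eq_m eqxx andbT.
have ubr r : (r <= K) && (F r == m) -> r <= K by case/andP.
case: (ex_maxnP exr ubr) => d /andP[le_d /eqP eqd] maxd.
exists d; split=> e he.
  by have := maxF e; have := leF e; have := leF d; rewrite -eqd /F; lia.
have [r le_r [e1 e2 _]] := cap e; rewrite e1 e2.
have neF : F r <> m.
  case: (leqP e K) => [leK|ltK eF].
    move=> eF; have := maxd e; rewrite leK /= /F e1 e2.
    by rewrite -/(F r) eF eqxx => /(_ isT); lia.
  apply: neK; rewrite -eF /F -e1 -e2 /F.
  by rewrite (eq_below_beyond f0 (ltnW ltK)) (eq_below_beyond g0 (ltnW ltK)).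
by have := maxF r; have := leF r; have := leF d; move: neF; rewrite -eqd /F; lia.
Qed.

(** * Column operators commute with row operators *)

Definition flip (M : incidence) : incidence := fun x c => M c x.

Lemma below_col_move c p (M : incidence) c' q : M c.+1 p -> M c p = false ->
  below (col_move c p M c') q + ((c' == c.+1) && (p < q)) =
  below (M c') q + ((c' == c) && (p < q)).
Proof.
move=> M1 M0; elim: q => [|q IH]; first by rewrite !andbF.
have [qp|nqp] := eqVneq q p; last first.
  have -> : below (col_move c p M c') q.+1 = below (col_move c p M c') q + M c' q.
    by rewrite /= {2}/col_move (negbTE nqp).
  by rewrite /= ltnS (leq_eqVlt p) (eq_sym p) (negbTE nqp) /=; lia.
subst q; move: IH; rewrite ltnn ltnSn /=.
have -> : col_move c p M c' p = (c' == c) || (c' != c.+1) && M c' p.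
  by rewrite /col_move eqxx.
have [->|ne] := eqVneq c' c; first by rewrite M0; lia.
by have [->|ne'] := eqVneq c' c.+1; rewrite ?M1; lia.
Qed.

Lemma below_row_move a d (M : incidence) c q : M d a.+1 -> M d a = false ->
  below (row_move a d M c) q = below (M c) q + ((c == d) && (q == a.+1)).
Proof.
move=> M1 M0; elim: q => [|q IH]; first by rewrite andbF.
have -> : below (row_move a d M c) q.+1 = below (row_move a d M c) q +
    (if c == d then (q == a) || (q != a.+1) && M c q else M c q) by [].
rewrite IH /=; have [->|ne] := eqVneq c d; last by lia.
case: (ltngtP q a) => lt; last by subst q; rewrite eqxx M0; lia.
  by lia.
have [->|ne] := eqVneq q a.+1; last by lia.
by rewrite M1; lia.
Qed.

Lemma row_below_row_move a d (M : incidence) x q : M d a.+1 -> M d a = false ->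
  below (flip (row_move a d M) x) q + ((x == a.+1) && (d < q)) =
  below (flip M x) q + ((x == a) && (d < q)).
Proof. exact: (@below_col_move a d (flip M) x q). Qed.

Lemma row_below_col_move c p (M : incidence) x q : M c.+1 p -> M c p = false ->
  below (flip (col_move c p M) x) q =
  below (flip M x) q + ((x == p) && (q == c.+1)).
Proof. exact: (@below_row_move c p (flip M) x q). Qed.

Definition col_raise (c p : nat) (M : incidence) := raises_at (M c) (M c.+1) p.
Definition row_lift (a d : nat) (M : incidence) :=
  lifts_at (flip M a) (flip M a.+1) d.

(** Otherwise the excess would already be larger one column to the left. *)
Lemma row_lift_neighbour a c (M : incidence) :
  row_lift a c.+1 M -> M c a.+1 -> M c a.
Proof.
by move=> [/(_ c (leqW (leqnn c))) /= + _]; rewrite /flip; case: (M c a); case: (M c a.+1); lia.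
Qed.

Lemma col_raise_neighbour c a (M : incidence) :
  col_raise c a M -> M c.+1 a.+1 -> M c a.+1.
Proof.
by move=> [_ /(_ a.+2 (leqW (leqnn _))) /=]; case: (M c a.+1); case: (M c.+1 a.+1); lia.
Qed.

(** The row operator changes the excess that governs the column operator only
    at the point a + 1, and increases it there only if d = c + 1.  In that
    case a neighbouring point of a + 1 already had the increased value, so the
    first maximum does not move. *)
Lemma col_raise_row_move c p a d M :
  col_raise c p M -> row_lift a d M ->
  (p, d) != (a, c) -> (p, d) != (a.+1, c.+1) ->
  col_raise c p (row_move a d M).
Proof.
move=> hc hr; rewrite !xpair_eqE => n1 n2.
have [C1 C0] := raises_at_mem hc; have [R1 R0] := lifts_at_mem hr.
rewrite /flip in R1 R0.
have br c' q := below_row_move c' q R1 R0.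
have nb : d = c.+1 -> M c a.+1 -> M c a by move=> dc; apply: row_lift_neighbour; rewrite -dc.
have vS c' q : below (M c') q.+1 = below (M c') q + M c' q by [].
case: hc => vl vg.
have fromS q : d = c.+1 -> q = a.+1 -> q != p.+1 /\
    (below (M c.+1) q + below (M c) a.+2 + 1 = below (M c.+1) a.+2 + below (M c) q \/
     below (M c.+1) q + below (M c) a + 1 = below (M c.+1) a + below (M c) q).
  move=> dc ->; split; first by apply/eqP => -[eq]; move: C1; rewrite -dc -eq R0.
  rewrite !vS; move: R1 R0; rewrite dc => -> ->.
  by move: (nb dc); case: (M c a.+1) => [->|] //=; [right|left]; lia.
have z1 : (c == d) && (p.+1 == a.+1) = false by rewrite eqSS; lia.
have z2 : (c.+1 == d) && (p.+1 == a.+1) = false.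
  rewrite eqSS; apply/negP => /andP[/eqP dc /eqP pa].
  by move: C1 R0; rewrite pa dc => ->.
split=> q hq; rewrite !br z1 z2; have [dc|ndc] := eqVneq c.+1 d.
- have [qa|nqa] := eqVneq q a.+1; last by have := vl q hq; lia.
  have [np [e|e]] := fromS q (esym dc) qa; last by have := vl a; lia.
  by have := vl a.+2; lia.
- by have := vl q hq; lia.
- have [qa|nqa] := eqVneq q a.+1; last by have := vg q hq; lia.
  have [np [e|e]] := fromS q (esym dc) qa; last by have := vg a; lia.
  by have := vg a.+2; lia.
by have := vg q hq; lia.
Qed.

(** The transposed argument: the excess that governs the row operator changes
    only at the column c + 1, up to a value that it already had at c or at
    c + 2. *)
Lemma row_lift_col_move c p a d M :
  col_raise c p M -> row_lift a d M ->
  (p, d) != (a, c) -> (p, d) != (a.+1, c.+1) ->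
  row_lift a d (col_move c p M).
Proof.
move=> hc hr; rewrite !xpair_eqE => n1 n2.
have [C1 C0] := raises_at_mem hc; have [R1 R0] := lifts_at_mem hr.
rewrite /flip in R1 R0.
have rc x q := row_below_col_move x q C1 C0.
have nb : p = a -> M c.+1 a.+1 -> M c a.+1.
  by move=> pa; apply: col_raise_neighbour; rewrite -pa.
have uS x q : below (flip M x) q.+1 = below (flip M x) q + M q x by [].
case: hr => ul ug.
have fromS q : p = a -> q = c.+1 -> q != d /\
    (below (flip M a) q + below (flip M a.+1) c.+2 + 1 =
     below (flip M a) c.+2 + below (flip M a.+1) q \/
     below (flip M a) q + below (flip M a.+1) c + 1 =
     below (flip M a) c + below (flip M a.+1) q).
  move=> pa ->; split; first by apply/eqP => eq; move: C1; rewrite pa eq R0.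
  rewrite !uS; move: C1 C0; rewrite pa => -> ->.
  move: (nb pa); case: (M c.+1 a.+1) => [->|] //=; [right|left]; lia.
have z1 : (a.+1 == p) && (d == c.+1) = false by lia.
have z2 : (a == p) && (d == c.+1) = false.
  apply/negP => /andP[/eqP pa /eqP dc].
  by move: C1 R0; rewrite pa dc => ->.
split=> q hq; rewrite !rc z1 z2; have [pa|npa] := eqVneq a p.
- have [qa|nqa] := eqVneq q c.+1; last by have := ul q hq; lia.
  have [np [e|e]] := fromS q (esym pa) qa; last by have := ul c; lia.
  by have := ul c.+2; lia.
- by have := ul q hq; lia.
- have [qa|nqa] := eqVneq q c.+1; last by have := ug q hq; lia.
  have [np [e|e]] := fromS q (esym pa) qa; last by have := ug c; lia.
  by have := ug c.+2; lia.
by have := ug q hq; lia.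
Qed.

Lemma col_row_moveC c p a d (M : incidence) :
  M c.+1 p -> M c p = false -> M d a.+1 -> M d a = false ->
  (p, d) != (a, c) -> (p, d) != (a.+1, c.+1) ->
  col_move c p (row_move a d M) = row_move a d (col_move c p M).
Proof.
move=> C1 C0 R1 R0; rewrite !xpair_eqE => n1 n2.
have n3 : (p == a) && (d == c.+1) = false.
  by apply/negP => /andP[/eqP pa /eqP dc]; move: C1 R0; rewrite pa dc => ->.
have n4 : (p == a.+1) && (d == c) = false.
  by apply/negP => /andP[/eqP pa /eqP dc]; move: R1 C0; rewrite pa dc => ->.
apply/funext=> c'; apply/funext=> x; rewrite /col_move /row_move.
have [xp|nx] := eqVneq x p; have [cd|nc] := eqVneq c' d => //.
subst x c'.
have [pa|npa] := eqVneq p a; have [dc|ndc] := eqVneq d c => /=.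
- by rewrite pa dc !eqxx in n1.
- by rewrite pa eqxx /= in n3; rewrite n3.
- by rewrite dc eqxx andbT in n4; rewrite n4.
by have [->|n5] := eqVneq p a.+1; have [->|n6] := eqVneq d c.+1 => //=.
Qed.

(** The positions p and d are kept, except when both operators act inside the
    block formed by the letters a, a + 1 and the columns c, c + 1.  There the
    maximality conditions leave one block for each of the two possible
    corners, and the other operator then acts at the other corner. *)
Lemma raise_lift_diamond c p a d M :
  col_raise c p M -> row_lift a d M ->
  exists p' d',
    [/\ col_raise c p' (row_move a d M), row_lift a d' (col_move c p M) &
        col_move c p' (row_move a d M) = row_move a d' (col_move c p M)].
Proof.
move=> hc hr.
have [n1|n1] := eqVneq (p, d) (a, c); last first.
  have [n2|n2] := eqVneq (p, d) (a.+1, c.+1); last first.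
    exists p, d; split; [exact: col_raise_row_move | exact: row_lift_col_move |].
    by have [? ?] := raises_at_mem hc; have [? ?] := lifts_at_mem hr; apply: col_row_moveC.
  case: n2 => ? ?; subst p d.
  have [C1 C0] := raises_at_mem hc; have [R1 R0] := lifts_at_mem hr; rewrite /flip in R1 R0.
  case: hc => vl vg; case: hr => ul ug.
  have B1 : M c a = false.
    apply/negP => nB.
    by have := vl a (leqW (leqnn _)); rewrite /= nB R0 C0 C1; lia.
  exists a, c; split.
  - split=> q hq; rewrite !below_row_move //=.
      by have := vl q; rewrite /= ?C0 ?C1 ?B1 ?R0; lia.
    by have := vg q; have := vl q; rewrite /= ?C0 ?C1 ?B1 ?R0; lia.
  - split=> q hq; rewrite !row_below_col_move //.
      by have := ul q; have := ul c; rewrite /= /flip ?C0 ?C1 ?B1 ?R0; lia.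
    by have := ug q; have := ul q; rewrite /= /flip ?C0 ?C1 ?B1 ?R0; lia.
  apply/funext=> c'; apply/funext=> x; rewrite /col_move /row_move.
  have [->|nx1] := eqVneq x a.+1; have [->|nc] := eqVneq c' c => //=.
  - by rewrite (ltn_eqF (ltnSn _)) ?(gtn_eqF (ltnSn _)) /=.
  - by have [->|nc1] := eqVneq c' c.+1; rewrite ?(gtn_eqF (ltnSn _)).
  - by rewrite (ltn_eqF (ltnSn _)) /=; case: (x == a).
  by have [->|nc1] := eqVneq c' c.+1; have [->|nxa] := eqVneq x a => //=.
case: n1 => ? ?; subst p d.
have [C1 C0] := raises_at_mem hc; have [R1 R0] := lifts_at_mem hr; rewrite /flip in R1 R0.
case: (hc) => vl vg; case: hr => ul ug.
have B1 : M c.+1 a.+1.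
  apply/negPn/negP => /negbTE nB.
  by have := ug c.+2 (leqW (leqnn _)); rewrite /= /flip C0 R1 nB C1; lia.
exists a.+1, c.+1; split.
- split=> q hq; rewrite !below_row_move //=.
    by have := vl q; have := vg q; rewrite /= ?C0 ?C1 ?B1 ?R1; lia.
  by have := vg q; rewrite /= ?C0 ?C1 ?B1 ?R1; lia.
- split=> q hq; rewrite !row_below_col_move //.
    by have := ul q; have := ug q; rewrite /= /flip ?C0 ?C1 ?B1 ?R1; lia.
  by have := ug q; rewrite /= /flip ?C0 ?C1 ?B1 ?R1; lia.
apply/funext=> c'; apply/funext=> x; rewrite /col_move /row_move.
have [->|nx1] := eqVneq x a.+1; have [->|nc] := eqVneq c' c => //=.
- by rewrite (ltn_eqF (ltnSn _)) ?(gtn_eqF (ltnSn _)) /=.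
- by have [->|nc1] := eqVneq c' c.+1; rewrite ?(gtn_eqF (ltnSn _)).
- by rewrite (ltn_eqF (ltnSn _)) /=; case: (x == a).
by have [->|nc1] := eqVneq c' c.+1; have [->|nxa] := eqVneq x a => //=.
Qed.

(** * Highest matrices and linked matrices *)

Definition supported K N (M : incidence) :=
  forall c x, M c x -> c < K /\ x < N.

Definition col_highest (M : incidence) := forall c p, ~ col_raise c p M.
Definition row_highest (M : incidence) := forall a d, ~ row_lift a d M.

Lemma supported_col_move K N c p M :
  supported K N M -> col_raise c p M -> supported K N (col_move c p M).
Proof.
move=> sM /raises_at_mem[C1 _] c' x; rewrite /col_move.
have [->|_] := eqVneq x p; last exact: sM.
have [? ?] := sM _ _ C1.
by have [->|_] := eqVneq c' c => /= [|/andP[_ /sM//]]; split; lia.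
Qed.

Lemma supported_col_move_inv K N c p M :
  c.+1 < K -> col_raise c p M -> supported K N (col_move c p M) -> supported K N M.
Proof.
move=> ltK /raises_at_mem[C1 _] sM c' x.
have [_ ltN] : c < K /\ p < N by apply: sM; rewrite /col_move !eqxx.
have := sM c' x; rewrite /col_move; have [->|_] := eqVneq x p => //.
have [->|n1] := eqVneq c' c => /=; first by move=> /(_ isT).
by have [->|n2] := eqVneq c' c.+1.
Qed.

Lemma supported_row_move K N a d M :
  supported K N M -> row_lift a d M -> supported K N (row_move a d M).
Proof.
move=> sM /lifts_at_mem[R1 _] c x; rewrite /row_move.
have [->|_] := eqVneq c d; last exact: sM.
have [? ?] := sM _ _ R1.
by have [->|_] := eqVneq x a => /= [|/andP[_ /sM//]]; split; lia.
Qed.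

Lemma col_highestP K N M : supported K N M -> col_highest M ->
  forall c q, below (M c.+1) q <= below (M c) q.
Proof.
move=> sM hM c q; rewrite leqNgt; apply/negP => lt_q.
have s0 c' x : N <= x -> ~~ M c' x by move=> leN; apply/negP => /sM[]; lia.
have [//|p hp] := @raises_at_exists _ _ N (s0 c) (s0 c.+1); first by exists q.
exact: hM hp.
Qed.

Lemma row_lift_exists K N a M : supported K N M ->
  (exists d, below (flip M a) K + below (flip M a.+1) d <
             below (flip M a) d + below (flip M a.+1) K) ->
  exists d, row_lift a d M.
Proof.
move=> sM; apply: lifts_at_exists.
  by move=> c leK; apply/negP => /sM[]; lia.
by move=> c leK; apply/negP => /sM[]; lia.
Qed.

Lemma row_highestP K N M : supported K N M -> row_highest M ->
  forall a d, below (flip M a) d + below (flip M a.+1) K <=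
              below (flip M a) K + below (flip M a.+1) d.
Proof.
move=> sM hM a d; rewrite leqNgt; apply/negP => lt_d.
have [//|e he] := @row_lift_exists K N a M sM; first by exists d.
exact: hM he.
Qed.

(** A column operator cannot create the possibility of a row operator: the
    excess that governs the latter grows only at the column c + 1, where its
    new value is an old value at c or at c + 2. *)
Lemma row_lift_before K N c p a d M :
  supported K N M -> c.+1 < K -> col_raise c p M -> row_lift a d (col_move c p M) ->
  exists e, row_lift a e M.
Proof.
move=> sM ltK hc hr; have [C1 C0] := raises_at_mem hc.
have rc x q := row_below_col_move x q C1 C0.
have nK : (K == c.+1) = false by lia.
have ltdK : d < K.
  by have [/(supported_col_move sM hc)[]] := lifts_at_mem hr.
have nb : p = a -> M c.+1 a.+1 -> M c a.+1.
  by move=> pa; apply: col_raise_neighbour; rewrite -pa.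
case: (hr) => _ /(_ _ ltdK); rewrite !rc nK !andbF !addn0 => gt0.
apply: (row_lift_exists sM).
have [/andP[/eqP ap /eqP dc]|n] := boolP ((a == p) && (d == c.+1)); last first.
  by exists d; lia.
subst a d; rewrite eqxx in gt0.
case E: (M c.+1 p.+1); last by exists c.+2; move: gt0; rewrite /= /flip E C1; lia.
by exists c; move: gt0; rewrite /= /flip (nb erefl E) C0; lia.
Qed.

Lemma col_raise_before K N c p a d M :
  supported K N M -> row_lift a d M -> col_raise c p (row_move a d M) ->
  exists q, col_raise c q M.
Proof.
move=> sM hr hc; have [R1 R0] := lifts_at_mem hr.
have br c' q := below_row_move c' q R1 R0.
have nb : d = c.+1 -> M c a.+1 -> M c a.
  by move=> dc; apply: row_lift_neighbour; rewrite -dc.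
have s0 c' x : N <= x -> ~~ M c' x by move=> leN; apply/negP => /sM[]; lia.
case: (hc) => /(_ 0 (leq0n _)) + _; rewrite !br /= => gt0.
apply: (@raises_at_exists _ _ N (s0 c) (s0 c.+1)).
have [/andP[/eqP dc /eqP pa]|n] := boolP ((d == c.+1) && (p.+1 == a.+1)); last first.
  by exists p.+1 => /=; lia.
case: pa => pa; subst p d; rewrite /flip in R1 R0.
case E: (M c a.+1); last by exists a.+2; move: gt0; rewrite /= R1 R0 E; lia.
by exists a; move: gt0; rewrite /= (nb erefl E) R0; lia.
Qed.

(** Only the columns before K are involved, so that the counts over these
    columns are invariants in both directions. *)
Inductive linked (K : nat) : incidence -> incidence -> Prop :=
| linked_refl M : linked K M M
| linked_up c p M M' : c.+1 < K -> col_raise c p M ->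
    linked K (col_move c p M) M' -> linked K M M'
| linked_down c p M M' : c.+1 < K -> col_raise c p M ->
    linked K M M' -> linked K (col_move c p M) M'.

Lemma linked_trans K M1 M2 M3 : linked K M1 M2 -> linked K M2 M3 -> linked K M1 M3.
Proof.
by elim=> // c p M M' lt hc _ IH /IH; [apply: linked_up | apply: linked_down].
Qed.

Lemma linked_sym K M1 M2 : linked K M1 M2 -> linked K M2 M1.
Proof.
elim=> [M|c p M M' lt hc _ IH|c p M M' lt hc _ IH]; first exact: linked_refl.
  by apply: linked_trans IH _; apply: linked_down lt hc _; apply: linked_refl.
by apply: linked_trans IH _; apply: linked_up lt hc _; apply: linked_refl.
Qed.

Lemma linked_supported K N M M' : linked K M M' -> supported K N M -> supported K N M'.
Proof.
elim=> // c p {}M {}M' lt hc _ IH sM; apply: IH; first exact: supported_col_move.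
exact: supported_col_move_inv sM.
Qed.

Lemma linked_row_sum K M M' x : linked K M M' ->
  below (flip M x) K = below (flip M' x) K.
Proof.
have eqK c p M0 : c.+1 < K -> col_raise c p M0 ->
  below (flip (col_move c p M0) x) K = below (flip M0 x) K.
  by move=> lt /raises_at_mem[? ?]; rewrite row_below_col_move //; lia.
by elim=> // c p {}M {}M' lt hc _ <-; rewrite eqK.
Qed.

(** Across an upward link this is the commutation lemma.  Across a downward
    link the row operator is first shown to act below the link, and
    commutation together with the uniqueness of its place identifies the
    result. *)
Lemma linked_row_lift K N M M' a d :
  supported K N M -> linked K M M' -> row_lift a d M ->
  exists2 e, row_lift a e M' & linked K (row_move a d M) (row_move a e M').
Proof.
move=> + lM; elim: lM d => [{}M|c p {}M {}M' lt hc _ IH|c p {}M {}M' lt hc _ IH] d sM hr.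
- by exists d => //; apply: linked_refl.
- have [q [e [hq he eqM]]] := raise_lift_diamond hc hr.
  have [e' he' lk] := IH _ (supported_col_move sM hc) he.
  by exists e' => //; apply: linked_up lt hq _; rewrite eqM.
have sM0 := supported_col_move_inv lt hc sM.
have [d0 hd0] := row_lift_before sM0 lt hc hr.
have [q [e [hq he eqM]]] := raise_lift_diamond hc hd0.
have [e' he' lk] := IH _ sM0 hd0.
exists e' => //; rewrite (lifts_at_uniq hr he) -eqM.
exact: linked_down lt hq lk.
Qed.

(** The path records the letters but not the columns: the columns at which the
    same operators act differ between linked matrices. *)
Inductive lift_path : seq nat -> incidence -> incidence -> Prop :=
| lift_path_nil M : lift_path [::] M M
| lift_path_cons a d s M M' : row_lift a d M ->
    lift_path s (row_move a d M) M' -> lift_path (a :: s) M M'.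

Lemma linked_lift_path K N s M1 M2 M1' :
  supported K N M1 -> linked K M1 M2 -> lift_path s M1 M1' ->
  exists2 M2', lift_path s M2 M2' & linked K M1' M2'.
Proof.
move=> + + hs; elim: hs M2 => [M|a d {}s M M' hd _ IH] M2 sM lk.
  by exists M2 => //; apply: lift_path_nil.
have [e he lk'] := linked_row_lift sM lk hd.
have [M2' hM2' lk2] := IH _ (supported_row_move sM hd) lk'.
by exists M2' => //; apply: lift_path_cons he hM2'.
Qed.

(** The place d can be read off from the result: seen from there it is the
    place of the inverse operator. *)
Lemma row_lift_inj a d1 d2 M1 M2 : row_lift a d1 M1 -> row_lift a d2 M2 ->
  row_move a d1 M1 = row_move a d2 M2 -> M1 = M2.
Proof.
have back d M : row_lift a d M ->
    raises_at (flip (row_move a d M) a.+1) (flip (row_move a d M) a) d.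
  move=> hd; have [R1 R0] := lifts_at_mem hd; case: hd => lo hi.
  have rr x q := row_below_row_move x q R1 R0; rewrite /flip in R1 R0.
  have F x : below (flip M x) d.+1 = below (flip M x) d + M d x by [].
  split=> q hq; have := rr a q; have := rr a d.+1; have := rr a.+1 q;
  have := rr a.+1 d.+1; rewrite !eqxx (gtn_eqF (ltnSn a)) (ltn_eqF (ltnSn a)).
    by have := lo q hq; rewrite !F R1 R0; lia.
  by have := hi q hq; rewrite !F R1 R0; lia.
have undo d M : row_lift a d M -> M = fun c x =>
    if c == d then (x != a) && ((x == a.+1) || row_move a d M c x)
    else row_move a d M c x.
  move=> /lifts_at_mem; rewrite /flip => -[R1 R0]; apply/funext => c; apply/funext => x.
  rewrite /row_move; have [->|//] := eqVneq c d.
  have [->|_] := eqVneq x a; first by rewrite R0.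
  by have [->|] := eqVneq x a.+1.
move=> h1 h2 eqM; have := back _ _ h1; rewrite eqM => /raises_at_uniq/(_ (back _ _ h2)).
by move=> eqd; subst d2; rewrite (undo _ _ h1) (undo _ _ h2) eqM.
Qed.

Lemma lift_path_inj s M1 M2 M' : lift_path s M1 M' -> lift_path s M2 M' -> M1 = M2.
Proof.
move=> h; elim: h M2 => [M M2 h|a d {}s M M'' hd _ IH M2 h]; inversion h; subst => //.
by apply: row_lift_inj hd _ (IH _ _) => //; eassumption.
Qed.

Lemma lift_path_supported K N s M M' :
  lift_path s M M' -> supported K N M -> supported K N M'.
Proof. by elim=> // a d {}s {}M {}M' hd _ IH sM; apply: IH; apply: supported_row_move. Qed.

Lemma lift_path_col_highest K N s M M' :
  lift_path s M M' -> supported K N M -> col_highest M -> col_highest M'.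
Proof.
elim=> // a d {}s {}M {}M' hd _ IH sM hM; apply: IH; first exact: supported_row_move.
by move=> c p /(col_raise_before sM hd)[q /hM].
Qed.

Lemma lift_path_col_size K N s M M' c :
  lift_path s M M' -> supported K N M -> below (M' c) N = below (M c) N.
Proof.
elim=> // a d {}s {}M {}M' hd _ IH sM; rewrite IH; last exact: supported_row_move.
have [R1 R0] := lifts_at_mem hd; rewrite below_row_move //.
by have [_ /ltn_eqF] := sM _ _ R1; rewrite eq_sym => ->; rewrite andbF addn0.
Qed.

(** Every row operator increases one of the counts [below (M c) q], which are
    bounded. *)
Lemma lift_to_highest K N M : supported K N M ->
  exists s M', lift_path s M M' /\ row_highest M'.
Proof.
pose total (M : incidence) := \sum_(c < K) \sum_(q < N) below (M c) q.
have bound M0 : total M0 <= \sum_(c < K) \sum_(q < N) q.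
  by apply: leq_sum => c _; apply: leq_sum => q _; apply: below_leq.
have [n] := ubnP ((\sum_(c < K) \sum_(q < N) q) - total M).
elim: n M => // n IH M ltn sM.
have [[a [d hd]]|no] := pselect (exists a d, row_lift a d M); last first.
  by exists [::], M; split; [apply: lift_path_nil | move=> a d h; apply: no; exists a, d].
have [R1 R0] := lifts_at_mem hd.
have [ltd lta] := sM _ _ R1.
have up : total M < total (row_move a d M).
  have -> : total (row_move a d M) = total M +
      \sum_(c < K) \sum_(q < N) ((c == d :> nat) && (q == a.+1 :> nat)).
    rewrite /total -big_split; apply: eq_bigr => c _ /=.
    by rewrite -big_split; apply: eq_bigr => q _; rewrite below_row_move.
  rewrite -addn1 leq_add2l (bigD1 (Ordinal ltd)) //= (bigD1 (Ordinal lta)) //=.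
  by rewrite !eqxx.
have [||s [M' [hs hM']]] := IH (row_move a d M).
- by have := bound (row_move a d M); lia.
- exact: supported_row_move.
by exists (a :: s), M'; split=> //; apply: lift_path_cons hd hs.
Qed.

(** * Uniqueness of highest and of extremal matrices *)

Lemma below_sum (p : pred nat) n : below p n = \sum_(i < n) p i.
Proof. by elim: n => [|n IH]; rewrite ?big_ord0 // big_ord_recr /= IH. Qed.

Lemma below_full (p : pred nat) n : (forall i, i < n -> p i) -> below p n = n.
Proof.
elim: n => //= n IH pn; rewrite IH ?pn ?addn1 // => i lt_i.
by apply: pn; apply: ltnW.
Qed.

Lemma below_eq_full (p : pred nat) n i : below p n = n -> i < n -> p i.
Proof.
elim: n => //= n IH; have := below_leq p n; case E: (p n) => le eq; last by lia.
by rewrite ltnS leq_eqVlt => /orP[/eqP->//|]; apply: IH; lia.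
Qed.

Lemma initial_segmentP (p : pred nat) n :
  (forall i, p i.+1 -> p i) -> (forall i, n <= i -> ~~ p i) ->
  forall i, p i = (i < below p n).
Proof.
move=> dn p0 i.
have dnle j k : j <= k -> p k -> p j.
  by move=> /subnK <-; elim: (k - j) => //= m IH; rewrite addSn => /dn.
apply/idP/idP => [pi|lt_i].
  rewrite -(@below_full p i.+1) => [|j le_j]; last exact: dnle pi.
  by apply: leq_below; rewrite ltnNge; apply/negP => /p0; rewrite pi.
apply/negPn/negP => npi; move: lt_i.
rewrite ltnNge (leq_trans _ (below_leq p i)) //.
case: (leqP n i) => [/leq_below->//|/ltnW le_i].
rewrite (eq_below_beyond _ le_i) // => j le_j.
by apply/negP => /(dnle _ _ le_j); apply/negP.
Qed.

(** By induction from the last column leftwards.  If column c contains x + 1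
    but not x, then the columns to the right of c, being initial segments
    dominated by column c, contain neither letter; so the bracket of x + 1 in
    column c is unmatched and a row operator would act. *)
Lemma highest_initial K N (M : incidence) :
  supported K N M -> col_highest M -> row_highest M ->
  forall c x, M c x.+1 -> M c x.
Proof.
move=> sM /(col_highestP sM) hc /(row_highestP sM) hr c.
have hcle c' d q : below (M (c' + d)) q <= below (M c') q.
  by elim: d => [|d IH]; rewrite ?addn0 // addnS; apply: leq_trans (hc _ _) IH.
have [n] := ubnP (K - c); elim: n c => // n IH c ltn x M1.
have [ltK _] := sM _ _ M1.
apply/negPn/negP => M0.
have empty c' : c < c' -> ~~ M c' x.
  move=> lt; apply/negP => Mc'.
  have := hcle c (c' - c) x.+1; rewrite subnKC ?(ltnW lt) //.
  rewrite [below (M c') _]below_full /= => [|i lti].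
    by rewrite (negbTE M0); have := below_leq (M c) x; lia.
  have dn j : M c' (i + j) -> M c' i.
    elim: j => [|j IHj]; first by rewrite addn0.
    rewrite addnS => /IH Hj; apply: IHj; apply: Hj.
    by have [? _] := sM _ _ Mc'; lia.
  by apply: (dn (x - i)); rewrite subnKC.
have empty1 c' : c < c' -> ~~ M c' x.+1.
  move=> lt; apply/negP => Mc'; have := empty _ lt; rewrite (IH _ _ _ Mc') //.
  by have [? _] := sM _ _ Mc'; lia.
have := hr x c.
rewrite (@eq_below_beyond (flip M x) c.+1 K) // (@eq_below_beyond (flip M x.+1) c.+1 K) //=.
by rewrite /flip M1 (negbTE M0); lia.
Qed.

(** The row operators that lead from M to a highest matrix Y lead from M' to a
    highest matrix Y'.  In both results every row is an initial segment of
    the columns, and linked matrices have equal row sums; hence Y = Y'. *)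
Lemma col_highest_linked_eq K N M M' :
  supported K N M -> col_highest M -> col_highest M' -> linked K M M' -> M = M'.
Proof.
move=> sM hM hM' lk; have sM' := linked_supported lk sM.
have [s [Y [hs hY]]] := lift_to_highest sM.
have [Y' hs' lkY] := linked_lift_path sM lk hs.
have sY := lift_path_supported hs sM; have sY' := lift_path_supported hs' sM'.
have hY' : row_highest Y'.
  by move=> a d /(linked_row_lift sY' (linked_sym lkY))[e /hY].
have cY := lift_path_col_highest hs sM hM.
have cY' := lift_path_col_highest hs' sM' hM'.
have form Z : supported K N Z -> col_highest Z -> row_highest Z ->
    forall c x, Z c x = (c < below (flip Z x) K).
  move=> sZ cZ rZ c x; apply: (@initial_segmentP (flip Z x) K) => [i|i leK].
    have ini := highest_initial sZ cZ rZ.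
    have dn j k : Z i.+1 (j + k) -> Z i.+1 j.
      by elim: k => [|k IH]; rewrite ?addn0 // addnS => /ini.
    rewrite /flip => Zi; apply: (@below_eq_full _ x.+1) => //.
    apply/eqP; rewrite eqn_leq below_leq /=.
    apply: leq_trans (col_highestP sZ cZ i x.+1).
    rewrite below_full // => j lej; apply: (dn _ (x - j)).
    by rewrite subnKC.
  by apply/negP => /sZ[]; lia.
apply: (lift_path_inj hs); suff -> : Y = Y' by [].
apply/funext => c; apply/funext => x.
by rewrite form // [RHS]form // (linked_row_sum x lkY).
Qed.

Lemma sum_below_exchange K (M : incidence) m :
  \sum_(c < K) below (M c) m = \sum_(x < m) below (flip M x) K.
Proof.
under eq_bigr do rewrite below_sum.
rewrite exchange_big; apply: eq_bigr => x _; exact/esym/below_sum.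
Qed.

Definition col_sizes K N (M : incidence) := [seq below (M c) N | c <- iota 0 K].

(** The extremal case of the Gale-Ryser theorem.  The column d has at most
    [minn m (below (E d) N)] entries among the first m letters.  The sum of
    these bounds over d is the same for E and for Y, Y attains all of them,
    and both matrices have the same number of entries among the first m
    letters; so E attains all bounds too. *)
Lemma extremal_below K N (Y E : incidence) m c :
  supported K N Y -> supported K N E ->
  (forall c x, Y c x.+1 -> Y c x) ->
  (forall x, below (flip E x) K = below (flip Y x) K) ->
  perm_eq (col_sizes K N E) (col_sizes K N Y) ->
  c < K -> below (E c) m = minn m (below (E c) N).
Proof.
move=> sY sE ini rows perm ltK.
have leE d : below (E d) m <= minn m (below (E d) N).
  rewrite leq_min below_leq /=; case: (leqP m N) => [/leq_below//|/ltnW le].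
  by rewrite (eq_below_beyond _ le) // => i lei; apply/negP => /sE[]; lia.
have eqY d : below (Y d) m = minn m (below (Y d) N).
  have s0 i : N <= i -> ~~ Y d i by move=> lei; apply/negP => /sY[]; lia.
  have iY := initial_segmentP (ini d) s0.
  case: leqP => [le|/ltnW le].
    by apply: below_full => i lti; rewrite iY; apply: leq_trans le.
  rewrite (@eq_below_beyond _ (below (Y d) N) m) // => [|i lei]; last by rewrite iY -leqNgt.
  by apply: below_full => i lti; rewrite iY.
have sumE : \sum_(d < K) below (E d) m = \sum_(d < K) minn m (below (E d) N).
  rewrite sum_below_exchange; under eq_bigr do rewrite rows.
  rewrite -sum_below_exchange; under eq_bigr do rewrite eqY.
  have toseq (F : incidence) :
      \sum_(d < K) minn m (below (F d) N) = \sum_(l <- col_sizes K N F) minn m l.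
    by rewrite big_map -(big_mkord predT (fun d => minn m (below (F d) N))) /index_iota subn0.
  by rewrite !toseq; apply/esym/perm_big.
apply/eqP; rewrite eqn_leq leE /= leqNgt; apply/negP => lt.
suff : \sum_(d < K) below (E d) m < \sum_(d < K) minn m (below (E d) N).
  by rewrite sumE ltnn.
rewrite (bigD1 (Ordinal ltK)) //= [X in _ < X](bigD1 (Ordinal ltK)) //= -addSn.
by apply: leq_add => //; apply: leq_sum => d _; apply: leE.
Qed.

(** The row operators that make T highest turn D1 and D2 into matrices whose
    columns are initial segments of prescribed lengths, hence into the same
    matrix; and row operators are injective. *)
Lemma extremal_linked_eq K N T D1 D2 :
  supported K N T -> col_highest T -> linked K T D1 -> linked K T D2 ->
  perm_eq (col_sizes K N D1) (col_sizes K N T) ->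
  col_sizes K N D1 = col_sizes K N D2 -> D1 = D2.
Proof.
move=> sT hT l1 l2 perm eqs.
have [s [Y [hs hY]]] := lift_to_highest sT.
have sY := lift_path_supported hs sT.
have iY := highest_initial sY (lift_path_col_highest hs sT hT) hY.
have nthS M c : c < K -> nth 0 (col_sizes K N M) c = below (M c) N.
  by move=> lt; rewrite (nth_map 0) ?size_iota // nth_iota.
have sizes s' M M' : lift_path s' M M' -> supported K N M -> col_sizes K N M' = col_sizes K N M.
  move=> hp sM; rewrite /col_sizes; apply: eq_map => c; exact: lift_path_col_size hp sM.
have key D E : linked K T D -> lift_path s D E -> linked K Y E ->
    perm_eq (col_sizes K N D) (col_sizes K N T) ->
    supported K N E /\ forall c m, c < K -> below (E c) m = minn m (nth 0 (col_sizes K N D) c).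
  move=> lD hE lE pD; have sD := linked_supported lD sT.
  have sE := lift_path_supported hE sD; split=> // c m ltc.
  rewrite -(sizes _ _ _ hE sD) nthS //.
  apply: (extremal_below m sY) => // [x|]; first exact/esym/linked_row_sum.
  by rewrite (sizes _ _ _ hE sD) (sizes _ _ _ hs sT).
have [E1 h1 k1] := linked_lift_path sT l1 hs.
have [E2 h2 k2] := linked_lift_path sT l2 hs.
have [s1 e1] := key _ _ l1 h1 k1 perm.
have [s2 e2] : supported K N E2 /\ forall c m, c < K ->
    below (E2 c) m = minn m (nth 0 (col_sizes K N D2) c).
  by apply: key => //; rewrite -eqs.
apply: (lift_path_inj h1); suff -> : E1 = E2 by [].
apply/funext => c; apply/funext => x.
case: (leqP K c) => [le|lt].
  by apply/idP/idP => [/s1[]|/s2[]]; lia.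
have := e1 c x.+1 lt; have := e1 c x lt; have := e2 c x.+1 lt; have := e2 c x lt.
by rewrite eqs /=; case: (E1 c x); case: (E2 c x) => //; lia.
Qed.

(** * The last column of an extremal matrix *)

(** One column operator lowers the maximal excess by exactly one, so it can
    be applied as many times as this maximum. *)
Lemma raise_times K N c j M :
  supported K N M -> c.+1 < K ->
  (exists q, below (M c) q + j <= below (M c.+1) q) ->
  exists M', [/\ linked K M M', forall d, d != c -> d != c.+1 -> M' d = M d,
    below (M' c) N = below (M c) N + j & below (M' c.+1) N + j = below (M c.+1) N].
Proof.
elim: j M => [|j IH] M sM ltK [q hq].
  by exists M; split; rewrite ?addn0 //; apply: linked_refl.
have s0 c' x : N <= x -> ~~ M c' x by move=> lex; apply/negP => /sM[]; lia.
have [|p hp] := raises_at_exists (s0 c) (s0 c.+1); first by exists q; lia.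
have [C1 C0] := raises_at_mem hp; have [_ ltN] := sM _ _ C1.
have bc c' r := below_col_move c' r C1 C0.
have neq : (c == c.+1) = false by lia.
have neq' : (c.+1 == c) = false by lia.
case: (hp) => lo hi.
have hM1 : exists r, below (col_move c p M c) r + j <= below (col_move c p M c.+1) r.
  exists p; have := bc c p; have := bc c.+1 p; rewrite !eqxx neq neq' ltnn /=.
  by case: (leqP q p) => [/lo|/hi]; rewrite /= C1 C0; lia.
have [M' [lk other e1 e2]] := IH _ (supported_col_move sM hp) ltK hM1.
exists M'; split.
- exact: linked_up ltK hp lk.
- move=> d n1 n2; rewrite other //; apply/funext => x.
  by rewrite /col_move (negbTE n1) n2 /= if_same.
- by rewrite e1; have := bc c N; rewrite !eqxx neq ltN /=; lia.
by rewrite addnS e2; have := bc c.+1 N; rewrite !eqxx neq' ltN /=; lia.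
Qed.

(** Two adjacent columns in the wrong order exchange their lengths after as
    many column operators as the lengths differ, because the final value of
    the excess is this difference.  Each exchange decreases the sum of the
    lengths weighted by the positions. *)
Lemma sort_columns K N n M : supported K N M -> n <= K ->
  exists M', [/\ linked K M M', forall d, n <= d -> M' d = M d,
    sorted geq (col_sizes n N M') & perm_eq (col_sizes n N M) (col_sizes n N M')].
Proof.
move=> + leK; pose w (M : incidence) := \sum_(c <- iota 0 n) c * below (M c) N.
have [m] := ubnP (w M); elim: m M => // m IH M ltm sM.
have [srt|] := boolP (sorted geq (col_sizes n N M)).
  by exists M; split => //; apply: linked_refl.
move=> nsrt.
have [c ltc hc] : exists2 c, c.+1 < n & below (M c) N < below (M c.+1) N.
  apply/not_exists2P => no; move/negP: nsrt; apply.
  apply/(sortedP 0) => i; rewrite size_map size_iota => lti.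
  rewrite !(nth_map 0) ?size_iota ?(ltnW lti) // !nth_iota ?(ltnW lti) // !add0n /=.
  by rewrite leqNgt; apply/negP => lt; case: (no i).
pose j := below (M c.+1) N - below (M c) N.
have [|M1 [lk other e1 e2]] := @raise_times K N c j M sM (leq_trans ltc leK).
  by exists N; rewrite /j; lia.
have split_iota : iota 0 n = iota 0 c ++ [:: c, c.+1 & iota c.+2 (n - c.+2)].
  have {1}-> : n = c + (n - c.+2).+2 by lia.
  by rewrite iotaD.
have same s : (forall d : nat, d \in s -> d != c /\ d != c.+1) ->
    [seq below (M1 d) N | d <- s] = [seq below (M d) N | d <- s].
  by move=> out; apply/eq_in_map => d /out[n1 n2]; rewrite other.
have out1 d : d \in iota 0 c -> d != c /\ d != c.+1 by rewrite mem_iota; lia.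
have out2 d : d \in iota c.+2 (n - c.+2) -> d != c /\ d != c.+1 by rewrite mem_iota; lia.
have ew : w M1 < w M.
  rewrite /w !split_iota !big_cat !big_cons /=.
  have eqs s : (forall d : nat, d \in s -> d != c /\ d != c.+1) ->
      \sum_(d <- s) d * below (M1 d) N = \sum_(d <- s) d * below (M d) N.
    by move=> out; apply: eq_big_seq => d /out[n1 n2]; rewrite other.
  rewrite !eqs // ltn_add2l e1 -e2; have : 0 < j by rewrite subn_gt0.
  by move: (\sum_(d <- _) _) => B; rewrite -/j; clearbody j; nia.
have pM : perm_eq (col_sizes n N M) (col_sizes n N M1).
  rewrite /col_sizes !split_iota !map_cat /=.
  rewrite !same //.
  have -> : below (M1 c) N = below (M c.+1) N by rewrite e1 /j; lia.
  have -> : below (M1 c.+1) N = below (M c) N by move: e2; rewrite /j; lia.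
  rewrite perm_cat2l.
  by apply/permP => q /=; rewrite addnCA.
have [||M' [lk' other' srt pM']] := IH M1.
- by lia.
- exact: linked_supported lk sM.
exists M'; split=> //; first exact: linked_trans lk lk'.
  by move=> d led; rewrite other' // other //; lia.
exact: perm_trans pM pM'.
Qed.

(** Sorting the other columns does not touch the last one and gives both
    matrices the same sequence of lengths. *)
Lemma extremal_last_col k N T D1 D2 :
  supported k.+1 N T -> col_highest T ->
  linked k.+1 T D1 -> linked k.+1 T D2 ->
  perm_eq (col_sizes k.+1 N D1) (col_sizes k.+1 N T) ->
  perm_eq (col_sizes k.+1 N D2) (col_sizes k.+1 N T) ->
  below (D1 k) N = below (D2 k) N -> D1 k = D2 k.
Proof.
move=> sT hT l1 l2 p1 p2 eqk.
have rc M : col_sizes k.+1 N M = rcons (col_sizes k N M) (below (M k) N).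
  by rewrite /col_sizes -addn1 iotaD map_cat cats1.
have [M1 [lk1 o1 s1 q1]] := sort_columns (linked_supported l1 sT) (leqnSn k).
have [M2 [lk2 o2 s2 q2]] := sort_columns (linked_supported l2 sT) (leqnSn k).
rewrite -o1 // -o2 //; suff -> : M1 = M2 by [].
apply: (extremal_linked_eq sT hT (linked_trans l1 lk1) (linked_trans l2 lk2)).
  by apply: perm_trans p1; rewrite !rc o1 // -!cats1 perm_cat2r perm_sym.
rewrite !rc !(o1, o2) // eqk; congr rcons.
apply: (@sorted_eq _ geq) => //.
- by move=> x y z /= h1 h2; apply: leq_trans h2 h1.
- by move=> x y /= h; apply/eqP; rewrite eqn_leq andbC.
rewrite -(permPl q1) -(permPr q2) -(perm_cat2r [:: below (D1 k) N]) cats1 eqk cats1.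
by rewrite -[in X in perm_eq X _]eqk -!rc; apply: perm_trans p1 _; rewrite perm_sym.
Qed.

(** * Exchanging the lengths of two adjacent columns *)

(** The unmatched opening brackets, in the bracketing of [raises_at]. *)
Definition unmatched (f g : pred nat) : pred nat := fun x =>
  `[< f x /\ forall q, x < q -> below g q + below f x < below g x + below f q >].

Lemma unmatched_at f g x : unmatched f g x -> f x /\ g x = false.
Proof. by move=> /asboolP[fx /(_ x.+1 (ltnSn x))] /=; rewrite fx; case: (g x); lia. Qed.

(** From q to z the excess of closing over opening brackets drops by at most
    the number of unmatched opening brackets between them, since a matched
    one is closed before the unmatched bracket z. *)
Lemma unmatched_bound f g z q : unmatched f g z -> q <= z ->
  below g q + below f z + below (unmatched f g) q <=
  below g z + below f q + below (unmatched f g) z.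
Proof.
set X := unmatched f g => Xz.
have [n] := ubnP (z - q); elim: n q => // n IH q ltn leq.
have [->|neq] := eqVneq q z; first by lia.
have [/asboolP[_ after]] := (Xz, leq); move=> _.
have IHS : below g q.+1 + below f z + below X q.+1 <= below g z + below f q.+1 + below X z.
  by apply: IH; lia.
move: IHS => /=; case Xq: (X q).
  by have [-> ->] := unmatched_at Xq; lia.
case fq: (f q); last by lia.
have [r ltr ler] : exists2 r, q < r & below g q + below f r <= below g r + below f q.
  apply/not_exists2P => no; move/negP: Xq; apply; apply/asboolP; split=> // r ltr.
  by rewrite ltnNge; apply/negP => le; case: (no r) => //; lia.
move=> _; case: (leqP r z) => [lerz|/after]; last first.
  by have := leq_below X leq; lia.
have := IH r; have := leq_below X (ltnW ltr); lia.
Qed.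

Definition lower_until (c z : nat) (M : incidence) : incidence := fun d x =>
  let moved := unmatched (M c) (M c.+1) x && (x < z) in
  if d == c then M c x && ~~ moved
  else if d == c.+1 then M c.+1 x || moved else M d x.

Lemma below_lower_left c z M q :
  below (lower_until c z M c) q + below (unmatched (M c) (M c.+1)) (minn q z) = below (M c) q.
Proof.
elim: q => [|q IH]; first by rewrite min0n.
rewrite /= -IH {2}/lower_until eqxx.
case: (leqP z q) => [le|lt].
  have -> : minn q.+1 z = z by lia.
  by rewrite andbF andbT /=; lia.
have -> : minn q.+1 z = q.+1 by lia.
rewrite andbT /=.
by case X: (unmatched _ _ q) => /=; [have [-> _] := unmatched_at X|]; lia.
Qed.

Lemma below_lower_right c z M q :
  below (lower_until c z M c.+1) q =
  below (M c.+1) q + below (unmatched (M c) (M c.+1)) (minn q z).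
Proof.
elim: q => [|q IH]; first by rewrite min0n.
rewrite /= IH {1}/lower_until (gtn_eqF (ltnSn c)) eqxx.
case: (leqP z q) => [le|lt].
  have -> : minn q.+1 z = z by lia.
  by rewrite andbF orbF; lia.
have -> : minn q.+1 z = q.+1 by lia.
rewrite andbT /=.
by case X: (unmatched _ _ q) => /=; [have [_ ->] := unmatched_at X|]; rewrite ?orbF; lia.
Qed.

(** Moving the unmatched letters from column c to column c + 1 in increasing
    order, the column operator undoes the latest move every time. *)
Lemma linked_lower K c z M : c.+1 < K -> linked K (lower_until c z M) M.
Proof.
move=> ltK; pose X := unmatched (M c) (M c.+1).
elim: z => [|z IH].
  suff -> : lower_until c 0 M = M by apply: linked_refl.
  apply/funext => d; apply/funext => x; rewrite /lower_until ltn0 andbF andbT orbF.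
  by have [->|_] := eqVneq d c => //; have [->|] := eqVneq d c.+1.
case Xz: (X z); last first.
  suff -> : lower_until c z.+1 M = lower_until c z M by [].
  apply/funext => d; apply/funext => x; rewrite /lower_until ltnS leq_eqVlt.
  by have [->|_] := eqVneq x z; rewrite ?Xz //=; move: Xz; rewrite /X => ->.
have [fz gz] := unmatched_at Xz.
have hz : col_raise c z (lower_until c z.+1 M).
  have /asboolP[_ after] := Xz.
  have L q := below_lower_left c z.+1 M q; have R q := below_lower_right c z.+1 M q.
  rewrite -/X in L R.
  have BS p q : below p q.+1 = below p q + p q by [].
  have := L z.+1; have := R z.+1; rewrite minnn !BS fz gz Xz -!BS => Rz Lz.
  split=> q hq; have := L q; have := R q.
    have := unmatched_bound Xz hq; have := leq_below X hq.
    have -> : minn q z.+1 = q by lia.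
    by rewrite -/X; lia.
  have -> : minn q z.+1 = z.+1 by lia.
  by have := after q hq; rewrite BS Xz; lia.
apply: (linked_up ltK hz).
suff -> : col_move c z (lower_until c z.+1 M) = lower_until c z M by [].
apply/funext => d; apply/funext => x; rewrite /col_move /lower_until.
have [->|nx] := eqVneq x z; last by rewrite ltnS leq_eqVlt (negbTE nx).
rewrite ltnn ltnSn !andbF fz gz /= -/X Xz /=.
by have [->|] := eqVneq d c => //=; have [->|] := eqVneq d c.+1.
Qed.

Definition incidence_of (Ds : seq (seq nat)) : incidence := fun c x => x \in nth [::] Ds c.

Lemma below_mem (s : seq nat) q : uniq s ->
  below (fun x => x \in s) q = count (fun x => x < q) s.
Proof.
move=> us; elim: q => [|q IH] /=; first by rewrite (eq_count (a2 := pred0)) ?count_pred0.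
rewrite IH -count_uniq_mem // -count_predUI.
rewrite [X in _ = X](eq_count (a2 := predU (fun x => x < q) (pred1 q))).
  rewrite -[RHS]addn0; congr addn.
  by rewrite (eq_count (a2 := pred0)) ?count_pred0 // => x /=; lia.
by move=> x /=; rewrite ltnS leq_eqVlt orbC.
Qed.

(** Columns are listed from bottom to top here, in decreasing order. *)
Fixpoint replace_desc (A C : seq nat) : seq nat :=
  if A is a :: A' then
    if C is c :: C' then
      if a <= c then c :: replace_desc A' C' else a :: replace_desc A' C
    else A
  else [::].

Lemma size_replace_desc A C : size (replace_desc A C) = size A.
Proof. by elim: A C => //= a A IH [|c C] //=; case: ifP => _ /=; rewrite IH. Qed.

Lemma mem_replace_desc_sub A C x : x \in replace_desc A C -> (x \in A) || (x \in C).
Proof.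
elim: A C => //= a A IH [|c C] /=; first by rewrite orbF.
case: ifP => _; rewrite !inE => /predU1P[->|/IH].
- by rewrite eqxx orbT.
- by case/orP => ->; rewrite !orbT.
- by rewrite eqxx.
by rewrite inE; case/orP => ->; rewrite ?orbT.
Qed.

Lemma gtn_sortedP a (s : seq nat) :
  path gtn a s = all (gtn a) s && sorted gtn s.
Proof.
have tr : transitive gtn by move=> x y z /= h1 h2; apply: ltn_trans h2 h1.
by rewrite path_sortedE.
Qed.

Lemma sorted_replace_desc A C : sorted gtn A -> sorted gtn C -> sorted gtn (replace_desc A C).
Proof.
elim: A C => //= a A IH [|c C] //=.
rewrite !gtn_sortedP => /andP[/allP aA sA] /andP[/allP cC sC].
case: leqP => [le|lt] /=; rewrite gtn_sortedP IH //= ?gtn_sortedP ?sC ?andbT //.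
  by apply/allP => x /mem_replace_desc_sub/orP[/aA|/cC] //= ltx; apply: leq_trans le.
  apply/allP => x /mem_replace_desc_sub; rewrite inE => /orP[/aA|/predU1P[->|/cC]] //=.
  by move=> /ltn_trans; apply.
by apply/allP.
Qed.

Lemma below_cons (a : nat) (s : seq nat) q : a \notin s ->
  below (fun x => x \in a :: s) q = below (fun x => x \in s) q + (a < q).
Proof.
move=> na; elim: q => //= q ->; rewrite inE.
have [->|nq] := eqVneq q a; first by rewrite (negbTE na) ltnn ltnSn !addn0.
by rewrite /= ltnS (leq_eqVlt a) (eq_sym a) (negbTE nq) /= addnAC.
Qed.

Lemma below_all_lt (s : seq nat) a q : all (gtn a) s -> a <= q ->
  below (fun x => x \in s) q = below (fun x => x \in s) a.
Proof.
by move=> /allP h; apply: eq_below_beyond => i lei; apply/negP => /h /=; rewrite ltnNge lei.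
Qed.

Lemma below_nil q : below (fun x => x \in [::]) q = 0.
Proof. by rewrite (@eq_below_beyond _ 0). Qed.

(** The greedy replacement keeps exactly the letters of A that are unmatched
    opening brackets.  Compare the largest letters a of A and c of C.  If
    a <= c, removing both changes the excess only between a and c, where A has
    no letters, so the unmatched letters below a stay the same.  If a > c, the
    letter a is unmatched and its removal affects no other letter. *)
Lemma mem_replace_desc A C : sorted gtn A -> sorted gtn C ->
  (forall q, below (fun x => x \in C) q <= below (fun x => x \in A) q) ->
  forall x, x \in replace_desc A C =
    (x \in C) || unmatched (fun x => x \in A) (fun x => x \in C) x.
Proof.
elim: A C => [|a A IH] [|c C] sA sC hi x.
- by apply/esym/negP => /unmatched_at[].
- move: sC; rewrite /= gtn_sortedP => /andP[/allP cC _].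
  have := hi c.+1; rewrite below_nil below_cons ?ltnSn; first by lia.
  by apply/negP => /cC; rewrite /= ltnn.
- apply/idP/idP => [xA|/unmatched_at[]//]; apply/asboolP; split=> // q ltq.
  by rewrite !below_nil; have := leq_below (fun x => x \in a :: A) ltq; rewrite /= xA; lia.
move: sA sC; rewrite /= !gtn_sortedP => /andP[aA sA] /andP[cC sC].
have naA : a \notin A by apply/negP => /(allP aA); rewrite /= ltnn.
have ncC : c \notin C by apply/negP => /(allP cC); rewrite /= ltnn.
pose FA q := below (fun x => x \in A) q; pose FC q := below (fun x => x \in C) q.
have fA q : below (fun x => x \in a :: A) q = FA q + (a < q) by apply: below_cons.
have fC q : below (fun x => x \in c :: C) q = FC q + (c < q) by apply: below_cons.
have FAa q : a <= q -> FA q = FA a by apply: below_all_lt.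
have FCc q : c <= q -> FC q = FC c by apply: below_all_lt.
have FCmono q r : q <= r -> FC q <= FC r by apply: leq_below.
have {}hi q : FC q + (c < q) <= FA q + (a < q) by rewrite -fA -fC.
have lta y : y \in A -> y < a by move/(allP aA).
case: leqP => [le|lt].
  rewrite inE IH // => [|q]; last first.
    rewrite -/(FA q) -/(FC q).
    case: (leqP q a) => [leqa|ltaq]; first by have := hi q; lia.
    have := hi (maxn q c.+1); have := FAa q (ltnW ltaq); have := FAa (maxn q c.+1).
    by have := FCmono q (maxn q c.+1); lia.
  rewrite inE -orbA; congr orb; congr orb; apply/asboolP/asboolP => -[].
    move=> xA after; split=> [|q ltq]; first by rewrite inE xA orbT.
    have ltxa := lta _ xA; rewrite !fA !fC.
    by have := after q ltq; rewrite -!/(FA _) -!/(FC _); lia.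
  rewrite inE => /predU1P[->|xA] after.
    exfalso; have := after c.+1 (leq_ltn_trans le (ltnSn _)); rewrite !fA !fC.
    by have := FAa c.+1 (leqW le); have := FCmono a c.+1; lia.
  have ltxa := lta _ xA; split=> // q ltq; rewrite -!/(FA _) -!/(FC _).
  have := after q ltq; rewrite !fA !fC.
  case: (leqP q a) => [leqa|ltaq]; first by lia.
  case: (leqP q c) => [leqc|ltcq]; last by lia.
  have := after c.+1 (leq_ltn_trans (ltnW ltxa) (leq_ltn_trans le (ltnSn _))).
  rewrite !fA !fC.
  by have := FAa q (ltnW ltaq); have := FAa c.+1 (leqW le); have := FCmono q c.+1; lia.
have scC : sorted gtn (c :: C) by rewrite /= gtn_sortedP cC.
rewrite inE IH // => [|q]; last first.
  rewrite fC -/(FA q); case: (leqP q a) => [leqa|ltaq]; first by have := hi q; lia.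
  by have := hi a; have := FAa q (ltnW ltaq); have := FCc q; have := FCc a; lia.
rewrite orbCA; congr orb; apply/idP/idP => [/predU1P[->|]|].
- apply/asboolP; split=> [|q ltq]; first by rewrite mem_head.
  by rewrite !fA !fC; have := FAa q (ltnW ltq); have := FCc q; have := FCc a; lia.
- move=> /asboolP[xA after]; apply/asboolP; split=> [|q ltq]; first by rewrite inE xA orbT.
  have ltxa := lta _ xA; have := after q ltq; rewrite !fA !fC -!/(FA _).
  by lia.
move=> /asboolP[]; rewrite inE => /predU1P[->|xA] after; first by rewrite eqxx.
apply/orP; right; apply/asboolP; split=> // q ltq.
have ltxa := lta _ xA.
have := after q ltq; rewrite !fA !fC -!/(FA _).
case: (leqP q a) => [leqa|ltaq]; first by lia.
have := after a ltxa; rewrite !fA !fC.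
by have := FAa q (ltnW ltaq); have := FCc q; have := FCc a; lia.
Qed.

(** * The scanning column as a fold over the columns *)

Definition swap_right (A C : seq nat) : seq nat := rev (replace_desc (rev A) (rev C)).

Definition swap_left (A C : seq nat) : seq nat :=
  [seq x <- A | (x \notin swap_right A C) || (x \in C)].

Definition dominates (A C : seq nat) : Prop :=
  forall q, below (fun x => x \in C) q <= below (fun x => x \in A) q.

Lemma size_swap_right A C : size (swap_right A C) = size A.
Proof. by rewrite size_rev size_replace_desc size_rev. Qed.

Lemma size_foldl_swap_right A Cs : size (foldl swap_right A Cs) = size A.
Proof. by elim: Cs A => //= C Cs IH A; rewrite IH size_swap_right. Qed.

Lemma swap_right_nil A : swap_right A [::] = A.
Proof. by rewrite /swap_right; case E: (rev A) => [|a s] /=; rewrite -?E ?revK // -[A]revK E. Qed.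

Lemma swap_right_rcons A a C c : swap_right (rcons A a) (rcons C c) =
  if a <= c then rcons (swap_right A C) c else rcons (swap_right A (rcons C c)) a.
Proof. by rewrite /swap_right !rev_rcons /=; case: ifP => _; rewrite rev_cons. Qed.

Lemma mem_swap_right_sub A C x : x \in swap_right A C -> (x \in A) || (x \in C).
Proof. by rewrite mem_rev => /mem_replace_desc_sub; rewrite !mem_rev. Qed.

Lemma sorted_swap_right A C : sorted ltn A -> sorted ltn C -> sorted ltn (swap_right A C).
Proof. by rewrite -!(rev_sorted gtn) /swap_right revK; apply: sorted_replace_desc. Qed.

Lemma mem_swap_right A C : sorted ltn A -> sorted ltn C -> dominates A C ->
  forall x, x \in swap_right A C =
    (x \in C) || unmatched (fun x => x \in A) (fun x => x \in C) x.
Proof.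
rewrite -!(rev_sorted gtn) => sA sC dom x.
have eqr s : (fun x : nat => x \in rev s) = (fun x => x \in s).
  by apply/funext => y; rewrite mem_rev.
by rewrite mem_rev mem_replace_desc // ?mem_rev ?eqr // => q; rewrite !eqr.
Qed.

Lemma mem_swap_left A C : sorted ltn A -> sorted ltn C -> dominates A C ->
  forall x, x \in swap_left A C =
    (x \in A) && ~~ unmatched (fun x => x \in A) (fun x => x \in C) x.
Proof.
move=> sA sC dom x; rewrite mem_filter mem_swap_right // andbC; congr andb.
case X: (unmatched _ _ x); last by case: (x \in C).
by have [_ ->] := unmatched_at X.
Qed.

Lemma sorted_ltn_uniq (s : seq nat) : sorted ltn s -> uniq s.
Proof. exact/sorted_uniq/ltnn/ltn_trans. Qed.

Lemma below_mem_size (s : seq nat) N : uniq s -> all (gtn N) s ->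
  below (fun x => x \in s) N = size s.
Proof. by move=> us; rewrite below_mem // all_count => /eqP. Qed.

Lemma lower_until_swap (pre post : seq (seq nat)) A C N :
  sorted ltn A -> sorted ltn C -> dominates A C -> all (gtn N) A ->
  incidence_of (pre ++ swap_left A C :: swap_right A C :: post) =
  lower_until (size pre) N (incidence_of (pre ++ A :: C :: post)).
Proof.
move=> sA sC dom /allP AN; apply/funext => d; apply/funext => x.
have at0 (X Y : seq nat) : nth [::] (pre ++ X :: Y :: post) (size pre) = X.
  by rewrite nth_cat ltnn subnn.
have at1 (X Y : seq nat) : nth [::] (pre ++ X :: Y :: post) (size pre).+1 = Y.
  by rewrite nth_cat ltnNge leqnSn subSnn.
rewrite /lower_until /incidence_of at0 at1.
have moved : unmatched (fun x => x \in A) (fun x => x \in C) x && (x < N) =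
    unmatched (fun x => x \in A) (fun x => x \in C) x.
  by case X: (unmatched _ _ x) => //=; have [/AN] := unmatched_at X.
rewrite moved; have [->|n1] := eqVneq d (size pre).
  by rewrite at0 mem_swap_left.
have [->|n2] := eqVneq d (size pre).+1; first by rewrite at1 mem_swap_right.
rewrite !nth_cat; case: ltnP => // le.
by have -> : d - size pre = (d - size pre - 2).+2 by lia.
Qed.

Lemma bounded_seq (s : seq nat) : exists N, all (gtn N) s.
Proof.
by exists (\max_(x <- s) x).+1; apply/allP => x xs; rewrite /= ltnS leq_bigmax_seq.
Qed.

(** The pair A, C is recovered from the exchanged pair by column operators. *)
Lemma linked_swap K pre post A C :
  sorted ltn A -> sorted ltn C -> dominates A C -> (size pre).+1 < K ->
  linked K (incidence_of (pre ++ swap_left A C :: swap_right A C :: post))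
           (incidence_of (pre ++ A :: C :: post)).
Proof.
move=> sA sC dom ltK; have [N AN] := bounded_seq A.
by rewrite (lower_until_swap pre post sA sC dom AN); apply: linked_lower.
Qed.

Lemma size_swap_left A C : sorted ltn A -> sorted ltn C -> dominates A C ->
  size (swap_left A C) = size C.
Proof.
move=> sA sC dom; have [N] := bounded_seq (A ++ C); rewrite all_cat => /andP[AN CN].
have ust := sorted_ltn_uniq (sorted_swap_right sA sC).
have uA := sorted_ltn_uniq sA; have uC := sorted_ltn_uniq sC.
have stN : all (gtn N) (swap_right A C).
  by apply/allP => x /mem_swap_right_sub/orP[/(allP AN)|/(allP CN)].
have loN : all (gtn N) (swap_left A C).
  by apply/allP => x; rewrite mem_filter => /andP[_ /(allP AN)].
have := below_lower_left 0 N (incidence_of [:: A; C]) N.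
have := below_lower_right 0 N (incidence_of [:: A; C]) N.
rewrite -(lower_until_swap [::] [::] sA sC dom AN) /incidence_of /=.
by rewrite !below_mem_size ?filter_uniq // size_swap_right; lia.
Qed.

(** Column A travels to the far right; every column C that it passes becomes a
    column of the same length on its left. *)
Fixpoint push_right (A : seq nat) (Cs : seq (seq nat)) : seq (seq nat) :=
  if Cs is C :: Cs' then swap_left A C :: push_right (swap_right A C) Cs' else [:: A].

(** Two columns that may stand next to each other in a tableau. *)
Definition column_le (C D : seq nat) : bool :=
  (size D <= size C) && all (fun r => nth 0 C r <= nth 0 D r) (iota 0 (size D)).

Lemma column_leP C D : reflect
  (size D <= size C /\ forall r, r < size D -> nth 0 C r <= nth 0 D r) (column_le C D).
Proof.
apply: (iffP andP) => -[le h]; split=> //.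
  by move=> r ltr; apply: (allP h); rewrite mem_iota add0n.
by apply/allP => r; rewrite mem_iota add0n; apply: h.
Qed.

Lemma column_le_trans : transitive column_le.
Proof.
move=> D C E /column_leP[le1 h1] /column_leP[le2 h2]; apply/column_leP; split.
  exact: leq_trans le2 le1.
by move=> r ltr; apply: leq_trans (h1 _ _) (h2 _ _); rewrite // (leq_trans ltr).
Qed.

Lemma column_le_dominates C D : sorted ltn C -> sorted ltn D -> column_le C D -> dominates C D.
Proof.
move=> sC sD /column_leP[le h] q; rewrite !below_mem ?sorted_ltn_uniq //.
elim: C D le h {sC sD} => [|x C IH] [|y D] //= le h.
have := h 0 (ltn0Sn _); have := IH D le (fun r => h r.+1); rewrite /=; lia.
Qed.

Lemma dominates_trans A B C : dominates A B -> dominates B C -> dominates A C.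
Proof. by move=> h1 h2 q; apply: leq_trans (h2 q) (h1 q). Qed.

Lemma swap_right_dominates A C : sorted ltn A -> sorted ltn C -> dominates A C ->
  dominates (swap_right A C) C.
Proof.
move=> sA sC dom q; have mem := mem_swap_right sA sC dom.
elim: q => //= q IH; rewrite mem; case: (q \in C) => /=; lia.
Qed.

(** The travelling column contains the letters of the column D that it has
    just passed, so it still dominates the next one. *)
Lemma linked_push_right K pre A D Cs :
  sorted ltn A -> sorted ltn D -> all (sorted ltn) Cs -> dominates A D -> path column_le D Cs ->
  size pre + size Cs < K ->
  linked K (incidence_of (pre ++ push_right A Cs)) (incidence_of (pre ++ A :: Cs)).
Proof.
elim: Cs pre A D => [|C Cs IH] pre A D sA sD /=; first by move=> *; apply: linked_refl.
move=> /andP[sC sCs] domD /andP[DC pC] ltK.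
have dom : dominates A C by apply: dominates_trans domD (column_le_dominates sD sC DC).
apply: linked_trans (linked_swap Cs sA sC dom _); last by lia.
rewrite -!(cat_rcons (swap_left A C)); apply: (IH _ _ C) => //.
- exact: sorted_swap_right.
- exact: swap_right_dominates.
by rewrite size_rcons; lia.
Qed.

Lemma push_right_props A D Cs :
  sorted ltn A -> sorted ltn D -> all (sorted ltn) Cs -> dominates A D -> path column_le D Cs ->
  [/\ map size (push_right A Cs) = rcons (map size Cs) (size A),
      all (sorted ltn) (push_right A Cs),
      last [::] (push_right A Cs) = foldl swap_right A Cs &
      forall P : pred nat, all P A -> all (all P) Cs -> all (all P) (push_right A Cs)].
Proof.
elim: Cs A D => [|C Cs IH] A D sA sD /=.
  by move=> *; rewrite sA; split=> // P ->.
move=> /andP[sC sCs] domD /andP[DC pC].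
have dom : dominates A C by apply: dominates_trans domD (column_le_dominates sD sC DC).
have [//|||||e1 e2 e3 e4] := IH (swap_right A C) C.
- exact: sorted_swap_right.
- by [].
- by [].
- exact: swap_right_dominates.
- by [].
rewrite e1 e2 size_swap_left // size_swap_right; split=> //.
- by rewrite andbT; apply: sorted_filter => //; apply: ltn_trans.
- by rewrite -e3; case: (Cs).
move=> P PA /andP[PC PCs]; rewrite e4 //.
  by rewrite andbT; apply/allP => x; rewrite mem_filter => /andP[_ /(allP PA)].
by apply/allP => x /mem_swap_right_sub/orP[/(allP PA)|/(allP PC)].
Qed.

(** What is left of the columns Cs after a scanning pass that reaches them
    with current value m. *)
Definition pop_ewis (m : nat) (Cs : seq (seq nat)) : seq (seq nat) :=
  [seq (if p.1 then drop_bottom p.2 else p.2) | p <- zip (ewis_mask m (bottoms Cs)) Cs].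

(** The bottom entry of the travelling column undergoes exactly the first
    scanning pass, independently of the entries above it. *)
Lemma foldl_swap_right_rcons A a Cs : all (fun C => C != [::]) Cs ->
  foldl swap_right (rcons A a) Cs =
  rcons (foldl swap_right A (pop_ewis a Cs))
        (last a (mask (ewis_mask a (bottoms Cs)) (bottoms Cs))).
Proof.
elim: Cs A a => //= C Cs IH A a /andP[C0 Cs0].
case/lastP: C C0 => // C c _; rewrite swap_right_rcons last_rcons /pop_ewis /= last_rcons.
have db : drop_bottom (rcons C c) = C.
  by rewrite /drop_bottom size_rcons /= -cats1 take_size_cat.
by case: leqP => _ /=; rewrite IH //= db.
Qed.

Lemma foldl_swap_right_drop_empty A Cs :
  foldl swap_right A (drop_empty Cs) = foldl swap_right A Cs.
Proof. by elim: Cs A => //= -[|x C] Cs IH A /=; rewrite IH // swap_right_nil. Qed.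

Lemma column_le_drop_bottom C D : C != [::] -> D != [::] ->
  column_le C D -> if last 0 C <= last 0 D then column_le (drop_bottom C) (drop_bottom D)
               else column_le (drop_bottom C) D.
Proof.
case/lastP: C => // C c _; case/lastP: D => // D d _.
have db s (x : nat) : drop_bottom (rcons s x) = s.
  by rewrite /drop_bottom size_rcons /= -cats1 take_size_cat.
rewrite !last_rcons !db => /column_leP[]; rewrite !size_rcons ltnS => le h.
case: leqP => [lecd|ltdc].
  apply/column_leP; split=> // r ltr; have := h r (ltnW ltr).
  by rewrite !nth_rcons ltr (leq_trans ltr le).
have lt : size D < size C.
  rewrite ltn_neqAle le andbT; apply/negP => /eqP eqs.
  have := h (size D) (ltnSn _); rewrite !nth_rcons eqs ltnn eqxx; lia.
apply/column_leP; rewrite size_rcons; split=> // r ltr; have := h r ltr.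
by rewrite nth_rcons (leq_trans ltr lt).
Qed.

Lemma column_le_drop_bottomr C D : column_le C D -> column_le C (drop_bottom D).
Proof.
case/lastP: D => // D d; rewrite /drop_bottom size_rcons /= -cats1 take_size_cat //.
move=> /column_leP[]; rewrite size_cat addn1 => le h; apply/column_leP; split; first exact: ltnW.
by move=> r ltr; have := h r (ltnW ltr); rewrite nth_cat ltr.
Qed.

(** If the bottom of C is removed and the bottom of the next column D is not,
    then the bottom of D is smaller, so that D is shorter than C. *)
Lemma path_pop_ewis C Cs : C != [::] -> all (fun C => C != [::]) Cs -> path column_le C Cs ->
  path column_le (drop_bottom C) (pop_ewis (last 0 C) Cs) /\
  forall m, last 0 C < m -> path column_le C (pop_ewis m Cs).
Proof.
elim: Cs C => //= D Cs IH C C0 /andP[D0 Cs0] /andP[CD pD].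
have [IH1 IH2] := IH D D0 Cs0 pD.
split=> [|m ltm]; rewrite /pop_ewis /=; have := column_le_drop_bottom C0 D0 CD.
  by case: leqP => [le|lt] /= ->; [apply: IH1|apply: IH2].
move=> _; case: leqP => [le|lt] /=; first by rewrite column_le_drop_bottomr.
by rewrite CD; apply: IH2.
Qed.

Lemma scan_col_foldl A Cs : all (fun C => C != [::]) (A :: Cs) -> path column_le A Cs ->
  scan_col (A :: Cs) = foldl swap_right A Cs.
Proof.
have [n] := ubnP (size A); elim: n A Cs => // n IH A Cs; rewrite ltnS => leA ne pA.
rewrite scan_col_rcons //; move: (ne) => /= /andP[A0 Cs0].
case/lastP: A A0 leA pA {ne} => // A a _; rewrite size_rcons => leA pA.
have db : drop_bottom (rcons A a) = A.
  by rewrite /drop_bottom size_rcons /= -cats1 take_size_cat.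
have A0 : rcons A a != [::] by case: (A).
have := (path_pop_ewis A0 Cs0 pA).1; rewrite last_rcons db => pp.
rewrite foldl_swap_right_rcons // /remove_ewis /ewis /= last_rcons /= db -/(pop_ewis a Cs).
congr rcons; rewrite -foldl_swap_right_drop_empty.
have nd := @drop_empty_nonempty (pop_ewis a Cs).
have pd : path column_le A (drop_empty (pop_ewis a Cs)).
  by apply: path_filter pp => //; apply: column_le_trans.
(* Once the first column is used up, no column has any entry left. *)
case: A leA {A0 db pA pp} pd => [|x A] leA pd; last first.
  by rewrite IH //=.
case: (drop_empty _) nd pd => //= C s /andP[C0 _] /andP[/column_leP[]]; by case: C C0.
Qed.

Lemma tableau_sorted_column_le zeta T : is_tableau zeta T -> sorted column_le T.
Proof.
move=> [/andP[_ sh] sz _ _ rows]; apply/(sortedP [::]) => i lti.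
apply/column_leP; split=> [|r ltr]; last exact: rows.
have := (sortedP 0 sh) i; rewrite -sz size_map => /(_ lti).
by rewrite !(nth_map [::]) // ltnW.
Qed.

Lemma nth_scanning T i : nth [::] (scanning T) i = scan_col (drop i T).
Proof.
by elim: T i => [|C T IH] [|i] //=; rewrite IH.
Qed.
Lemma size_scanning T : size (scanning T) = size T.
Proof. by elim: T => //= C T ->. Qed.

(** * Slides are compositions of column operators *)

Definition height (U : seq (seq (option nat))) (c : nat) : nat := size (nth [::] U c).

(** The order is required for all pairs of comparable boxes, not only for
    adjacent ones; a hole then needs no separate condition across it. *)
Definition ordered (U : seq (seq (option nat))) : Prop :=
  forall c r x c' r' y, entry U c r = Some x -> entry U c' r' = Some y ->
    c <= c' -> r <= r' -> x <= y /\ (r < r' -> x < y).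

Definition decreasing (f : nat -> nat) : Prop := forall c, f c.+1 <= f c.

Lemma decreasing_leq f c d : decreasing f -> c <= d -> f d <= f c.
Proof.
move=> df /subnK <-; elim: (d - c) => //= k; rewrite addSn.
exact: leq_trans (df _).
Qed.

(** A skew tableau of inner shape eta during a slide, with its hole at (c, r). *)
Record holed (eta : nat -> nat) (U : seq (seq (option nat))) (c r : nat) : Prop := Holed {
  holed_eta : decreasing eta;
  holed_height : decreasing (height U);
  holed_le : forall d, eta d <= height U d;
  holed_box : eta c <= r < height U c;
  holed_some : forall d s, isSome (entry U d s) =
    [&& eta d <= s, s < height U d & (d, s) != (c, r)];
  holed_ordered : ordered U }.

Record skew (eta : nat -> nat) (U : seq (seq (option nat))) : Prop := Skew {
  skew_eta : decreasing eta;
  skew_height : decreasing (height U);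
  skew_le : forall d, eta d <= height U d;
  skew_some : forall d s, isSome (entry U d s) = (eta d <= s < height U d);
  skew_ordered : ordered U;
  skew_nonempty : all (fun C : seq (option nat) => C != [::]) U }.

Definition skew_incidence (U : seq (seq (option nat))) : incidence :=
  fun c x => Some x \in nth [::] U c.

Lemma entry_lt U c r x : entry U c r = Some x -> r < height U c.
Proof. by rewrite ltnNge => e; apply/negP => le; move: e; rewrite /entry nth_default. Qed.

Lemma height_gt0 U c : 0 < height U c -> c < size U.
Proof. by case: (leqP (size U) c) => // le; rewrite /height nth_default. Qed.

Lemma skew_incidenceP U c x : reflect (exists r, entry U c r = Some x) (skew_incidence U c x).
Proof.
apply: (iffP (nthP None)) => [[r _ e]|[r e]]; first by exists r.
by exists r => //; apply: entry_lt e.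
Qed.

Lemma eq_skew_incidence U V : (forall c r, entry U c r = entry V c r) ->
  skew_incidence U = skew_incidence V.
Proof.
move=> eqe; apply/funext => c; apply/funext => x.
by apply/skew_incidenceP/skew_incidenceP => -[r e]; exists r; rewrite ?eqe // -eqe.
Qed.

Lemma entry_set_entry U c r o d s :
  entry (set_entry U c r o) d s = if (d, s) == (c, r) then o else entry U d s.
Proof.
rewrite /entry /set_entry nth_set_nth /= xpair_eqE.
by have [->|_] //= := eqVneq d c; rewrite nth_set_nth.
Qed.

Lemma height_set_entry U c r o d : r < height U c -> height (set_entry U c r o) d = height U d.
Proof.
rewrite /height /set_entry nth_set_nth /=; have [->|_] //= := eqVneq d c.
by rewrite size_set_nth => /maxn_idPr.
Qed.

Lemma size_set_entry U c r o : r < height U c -> size (set_entry U c r o) = size U.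
Proof.
move=> lt; rewrite size_set_nth; apply/maxn_idPr/height_gt0.
exact: leq_ltn_trans lt.
Qed.

Lemma column_entries_sorted (C : seq (option nat)) :
  (forall i j x y, nth None C i = Some x -> nth None C j = Some y -> i < j -> x < y) ->
  sorted ltn (column_entries C).
Proof.
elim: C => //= o C IH h.
have {}IH := IH (fun i j x y e1 e2 lt => h i.+1 j.+1 x y e1 e2 lt).
case: o h => //= x h; rewrite path_sortedE; last exact: ltn_trans.
rewrite IH andbT; apply/allP => y; rewrite mem_pmap map_id => /(nthP None)[j _ e].
exact: (h 0 j.+1).
Qed.

Lemma ordered_column U c : ordered U -> sorted ltn (column_entries (nth [::] U c)).
Proof.
move=> oU; apply: column_entries_sorted => i j x y e1 e2 lt.
by have [_] := oU c i x c j y e1 e2 (leqnn c) (ltnW lt); apply.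
Qed.

Definition entry_below (q : nat) (o : option nat) : bool := if o is Some x then x < q else false.

Lemma below_entries U c n q : ordered U -> height U c <= n ->
  below (skew_incidence U c) q = \sum_(i < n) entry_below q (entry U c i).
Proof.
move=> oU; rewrite /entry /height; move: (ordered_column c oU).
rewrite /skew_incidence; move: (nth [::] U c) => C srt len.
have -> : (fun x => Some x \in C) = (fun x => x \in column_entries C).
  by apply/funext => x; rewrite mem_pmap map_id.
rewrite below_mem; last exact: sorted_ltn_uniq.
elim: C n len {srt} => [|o C IH] [|n] //= len.
- by rewrite big_ord0.
- by rewrite big1 // => i _; rewrite nth_nil.
by rewrite big_ord_recl -IH //; case: o.
Qed.

Definition move_entry (U : seq (seq (option nat))) c r d s x :=
  set_entry (set_entry U c r (Some x)) d s None.

Section Moves.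

Variables (eta : nat -> nat) (U : seq (seq (option nat))) (c r : nat).
Hypothesis hU : holed eta U c r.

Lemma holed_none : entry U c r = None.
Proof.
case: hU => _ _ _ _ /(_ c r) + _; rewrite eqxx !andbF.
by case: (entry U c r).
Qed.

Lemma height_move d s x e : s < height U d -> height (move_entry U c r d s x) e = height U e.
Proof.
case: hU => _ _ _ /andP[_ lt] _ _ lts.
by rewrite height_set_entry height_set_entry.
Qed.

Lemma entry_move d s x e t : entry (move_entry U c r d s x) e t =
  if (e, t) == (d, s) then None else if (e, t) == (c, r) then Some x else entry U e t.
Proof. by rewrite !entry_set_entry. Qed.

Lemma size_move d s x : s < height U d -> size (move_entry U c r d s x) = size U.
Proof.
case: hU => _ _ _ /andP[_ lt] _ _ lts.
by rewrite size_set_entry ?size_set_entry // height_set_entry.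
Qed.

Lemma holed_move d s x : entry U d s = Some x -> (d, s) != (c, r) ->
  (forall e t y, entry U e t = Some y -> e <= c -> t <= r -> y <= x /\ (t < r -> y < x)) ->
  (forall e t y, entry U e t = Some y -> (e, t) != (d, s) ->
     c <= e -> r <= t -> x <= y /\ (r < t -> x < y)) ->
  holed eta (move_entry U c r d s x) d s.
Proof.
move=> ex neq lo hi; have lts := entry_lt ex; case: (hU) => h1 h2 h3 h4 h5 h6.
have [leds _] : eta d <= s /\ True.
  by split=> //; have := h5 d s; rewrite ex => /esym/and3P[].
split=> //.
- by move=> e; rewrite !height_move.
- by move=> e; rewrite height_move.
- by rewrite height_move // leds.
- move=> e t; rewrite entry_move height_move //.
  have [_|n1] := eqVneq (e, t) (d, s); first by rewrite !andbF.
  rewrite andbT; have [[-> ->]|n2] := eqVneq (e, t) (c, r); first by rewrite h4.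
  by rewrite h5 n2 andbT.
move=> e t y e' t' y'; rewrite !entry_move.
have [//|n1] := eqVneq (e, t) (d, s); have [//|n2] := eqVneq (e', t') (d, s).
have [[-> ->] [<-]|n3] := eqVneq (e, t) (c, r); have [[-> ->]|n4] := eqVneq (e', t') (c, r).
- by move=> [<-] _ _; rewrite ltnn.
- by move=> e'y'; apply: hi.
- by move=> ey [<-]; apply: lo.
exact: h6.
Qed.

Lemma holed_down b : entry U c r.+1 = Some b ->
  (forall a, entry U c.+1 r = Some a -> b <= a) ->
  holed eta (move_entry U c r c r.+1 b) c r.+1 /\
  skew_incidence (move_entry U c r c r.+1 b) = skew_incidence U.
Proof.
move=> eb ha; case: (hU) => h1 h2 h3 /andP[h4 h4'] h5 h6.
have neq : (c, r.+1) != (c, r) by rewrite xpair_eqE eqxx /=; lia.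
split.
  apply: holed_move => // [e t y ey lee let_|e t y ey net lee let_].
    have [h7 h8] := h6 _ _ _ _ _ _ ey eb lee (leqW let_); split=> // lt.
    by apply: h8; apply: leqW.
  have [lec|ltc] := leqP e c.
    have ec : e = c by lia.
    subst e; have ltt : r < t.
      rewrite ltn_neqAle let_ andbT; apply/negP => /eqP rt.
      by move: ey; rewrite -rt holed_none.
    have ltt' : r.+1 < t.
      by rewrite ltn_neqAle ltt andbT eq_sym; move: net; rewrite xpair_eqE eqxx.
    have [_ /(_ ltt') lt] := h6 _ _ _ _ _ _ eb ey lee ltt.
    by split=> //; apply: ltnW.
  have : isSome (entry U c.+1 r).
    rewrite h5 xpair_eqE (gtn_eqF (ltnSn c)) andbT (leq_trans (h1 c)) //=.
    have := entry_lt ey; have := decreasing_leq h2 ltc; lia.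
  case ea: (entry U c.+1 r) => [a|] // _.
  have leba := ha _ ea.
  have [h7 h8] := h6 _ _ _ _ _ _ ea ey ltc let_.
  by split=> [|/h8]; [apply: leq_trans h7|apply: leq_ltn_trans].
apply/funext => d; apply/funext => x.
apply/skew_incidenceP/skew_incidenceP => -[s]; rewrite ?entry_move.
  case: ifP => // _; case: ifP => [/eqP[-> _] [<-]|_ e]; first by exists r.+1.
  by exists s.
move=> e; have [[ed es]|n1] := eqVneq (d, s) (c, r.+1).
  exists r; rewrite entry_move ed !xpair_eqE !eqxx /= (ltn_eqF (ltnSn r)) -eb.
  by rewrite -e ed es.
exists s; rewrite entry_move (negbTE n1).
have [[ed es]|//] := eqVneq (d, s) (c, r).
by move: e; rewrite ed es holed_none.
Qed.

(** In the rows other than r the columns c and c + 1 are aligned: a box of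
    column c above the hole has a right neighbour which is at most as large as
    a, and a box of column c + 1 below the hole has a left neighbour.  Row by
    row comparison of the counts then shows that a is the last unmatched
    closing bracket. *)
Lemma holed_right a : entry U c.+1 r = Some a ->
  (forall b, entry U c r.+1 = Some b -> a < b) ->
  [/\ holed eta (move_entry U c r c.+1 r a) c.+1 r,
      col_raise c a (skew_incidence U) &
      skew_incidence (move_entry U c r c.+1 r a) = col_move c a (skew_incidence U)].
Proof.
move=> ea hb; case: (hU) => h1 h2 h3 /andP[h4 h4'] h5 h6.
have neq : (c.+1, r) != (c, r) by rewrite xpair_eqE eqxx andbT /=; lia.
have below_a s y : entry U c s = Some y -> r < s -> a < y.
  move=> ey lts.
  have : isSome (entry U c r.+1).
    rewrite h5 xpair_eqE eqxx /= (gtn_eqF (ltnSn r)) andbT (leq_trans h4) //=.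
    by apply: leq_trans (entry_lt ey).
  case eb: (entry U c r.+1) => [b|] // _.
  have [leby _] := h6 _ _ _ _ _ _ eb ey (leqnn c) lts.
  exact: leq_trans (hb _ eb) leby.
have above_a s y : entry U c s = Some y -> s < r ->
    exists2 z, entry U c.+1 s = Some z & y <= z < a.
  move=> ey lts; have : isSome (entry U c.+1 s).
    have := h5 c s; rewrite ey => /esym/and3P[les _ _].
    rewrite h5 xpair_eqE (gtn_eqF (ltnSn c)) andbT (leq_trans (h1 c)) //=.
    exact: ltn_trans lts (entry_lt ea).
  case ez: (entry U c.+1 s) => [z|] // _; exists z => //.
  have [-> _] := h6 _ _ _ _ _ _ ey ez (leqnSn c) (leqnn s).
  by have [_ ->] := h6 _ _ _ _ _ _ ez ea (leqnn _) (ltnW lts).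
split.
- apply: holed_move => // [e t y ey lee let_|e t y ey net lee let_].
    exact: h6 ey ea (leqW lee) let_.
  have [lec|ltc] := leqP e c; last exact: h6 ea ey ltc let_.
  have ec : e = c by lia.
  subst e; have ltt : r < t.
    rewrite ltn_neqAle let_ andbT; apply/negP => /eqP rt.
    by move: ey; rewrite -rt holed_none.
  by have lt := below_a _ _ ey ltt; split=> // ; apply: ltnW.
- have hc := leqnn (height U c); have hc1 := h2 c.
  have lt1 := entry_lt ea.
  have some_below s : r < s -> isSome (entry U c.+1 s) -> isSome (entry U c s).
    move=> lts; rewrite !h5 !xpair_eqE eqxx /= => /and3P[_ lt _].
    by rewrite (leq_trans h4 (ltnW lts)) (leq_trans lt) // (gtn_eqF lts).
  have rows s x y : entry U c s = Some x -> entry U c.+1 s = Some y -> x <= y.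
    by move=> ex ey; have [] := h6 _ _ _ _ _ _ ex ey (leqnSn c) (leqnn s).
  have col1 s y : entry U c.+1 s = Some y -> s <= r -> y <= a.
    by move=> ey les; have [] := h6 _ _ _ _ _ _ ey ea (leqnn _) les.
  have E d q : d <= c.+1 -> c <= d ->
      below (skew_incidence U d) q = \sum_(i < height U c) entry_below q (entry U d i).
    move=> led lec; apply: below_entries => //.
    exact: decreasing_leq h2 lec.
  split=> q hq; rewrite !E // -!big_split /=.
    have ltr : r < height U c by [].
    rewrite (bigD1 (Ordinal ltr)) //= [X in _ < X](bigD1 (Ordinal ltr)) //= holed_none ea /=.
    have le : \sum_(i < height U c | i != Ordinal ltr)
        (entry_below q (entry U c.+1 i) + entry_below a.+1 (entry U c i)) <=
        \sum_(i < height U c | i != Ordinal ltr)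
        (entry_below a.+1 (entry U c.+1 i) + entry_below q (entry U c i)).
      apply: leq_sum => i; rewrite -val_eqE /= => ni.
      case ex: (entry U c i) => [x|] /=; last by case: (entry U c.+1 i) => [y|] //=; lia.
      case: (ltngtP i r) ni => // [lt|lt] _.
        have [z -> /andP[le1 le2]] := above_a _ _ ex lt; rewrite /=; lia.
      by have := below_a _ _ ex lt; case: (entry U c.+1 i) => [y|] //=; lia.
    by rewrite (ltnSn a) (ltnNge a) hq; exact: le.
  apply: leq_sum => i _.
  case ey: (entry U c.+1 i) => [y|] /=; last by case: (entry U c i) => [x|] //=; lia.
  have [ler|ltr] := leqP i r.
    have leya := col1 _ _ ey ler.
    by case ex: (entry U c i) => [x|] /=; [have := rows _ _ _ ex ey|]; lia.
  have := some_below _ ltr; rewrite ey => /(_ isT).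
  case ex: (entry U c i) => [x|] //= _.
  by have := rows _ _ _ ex ey; have := below_a _ _ ex ltr; lia.
have inj s : entry U c.+1 s = Some a -> s = r.
  move=> es; case: (ltngtP s r) => // lt.
    by have [_ /(_ lt)] := h6 _ _ _ _ _ _ es ea (leqnn _) (ltnW lt); rewrite ltnn.
  by have [_ /(_ lt)] := h6 _ _ _ _ _ _ ea es (leqnn _) (ltnW lt); rewrite ltnn.
apply/funext => d; apply/funext => x; rewrite /col_move.
have other : (d, x) != (c, a) -> (d, x) != (c.+1, a) ->
    skew_incidence (move_entry U c r c.+1 r a) d x = skew_incidence U d x.
  move=> n1 n2; apply/skew_incidenceP/skew_incidenceP => -[s]; rewrite ?entry_move => e.
    exists s; move: e; case: ifP => // _; case: ifP => // /eqP[ed _] [ex].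
    by rewrite ed ex eqxx in n1.
  exists s; rewrite entry_move; case: ifP => [/eqP[ed es]|_].
    move: n2 e; rewrite ed es ea xpair_eqE eqxx => /negP ne [ex].
    by case: ne; rewrite ex eqxx.
  by case: ifP => // /eqP[ed es]; move: e; rewrite ed es holed_none.
have [ex|nx] := eqVneq x a; last first.
  by apply: other; rewrite xpair_eqE (negbTE nx) andbF.
subst x; have [->|n1] := eqVneq d c => /=.
  apply/skew_incidenceP; exists r; rewrite entry_move eqxx.
  by rewrite eq_sym (negbTE neq).
have [->|n2] := eqVneq d c.+1 => /=.
  apply/skew_incidenceP => -[s]; rewrite entry_move.
  have [//|n2] := eqVneq (c.+1, s) (c.+1, r).
  rewrite xpair_eqE (gtn_eqF (ltnSn c)) /= => /inj es.
  by rewrite es eqxx in n2.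
by apply: other; rewrite xpair_eqE ?(negbTE n1) ?(negbTE n2).
Qed.

Lemma nth_drop_empty (W : seq (seq (option nat))) d :
  decreasing (height W) -> nth [::] (drop_empty W) d = nth [::] W d.
Proof.
elim: W d => //= C W IH d dW.
have dW' : decreasing (height W) by move=> e; apply: dW e.+1.
case: C dW => [|o C] dW /=; last by case: d => //= d; apply: IH.
have empty e : nth [::] W e = [::].
  by apply/nilP; have := decreasing_leq dW (leq0n e.+1); rewrite /height /= leqn0.
rewrite IH // empty; case: d => //= d; exact/esym/empty.
Qed.

Lemma holed_stop : entry U c r.+1 = None -> entry U c.+1 r = None ->
  let V := drop_empty (set_nth [::] U c (drop_bottom (nth [::] U c))) in
  skew eta V /\ skew_incidence V = skew_incidence U.
Proof.
move=> eb ea V; case: (hU) => h1 h2 h3 /andP[h4 h4'] h5 h6.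
have hr : height U c = r.+1.
  apply/eqP; rewrite eqn_leq h4' andbT leqNgt; apply/negP => lt.
  by have := h5 c r.+1; rewrite eb lt (leqW h4) xpair_eqE (gtn_eqF (ltnSn r)) andbF.
have hr1 : height U c.+1 <= r.
  rewrite leqNgt; apply/negP => lt.
  have := h5 c.+1 r; rewrite ea lt (leq_trans (h1 c) h4) xpair_eqE.
  by rewrite (gtn_eqF (ltnSn c)).
pose W := set_nth [::] U c (drop_bottom (nth [::] U c)).
have nW d : nth [::] W d = if d == c then take r (nth [::] U c) else nth [::] U d.
  by rewrite nth_set_nth /= /drop_bottom -/(height U c) hr.
have hW d : height W d = if d == c then r else height U d.
  rewrite /height nW; case: eqP => // _.
  by rewrite size_take -/(height U c) hr ltnSn.
have dW : decreasing (height W).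
  move=> d; rewrite !hW; have [e|n1] := eqVneq d.+1 c.
    have -> : (d == c) = false by lia.
    by have := h2 d; rewrite e hr; apply: ltnW.
  by have [->|n2] := eqVneq d c; [apply: hr1|apply: h2].
have nV d : nth [::] V d = nth [::] W d by apply: nth_drop_empty.
have hV d : height V d = if d == c then r else height U d by rewrite /height nV -/(height W d).
have eV d s : entry V d s = entry U d s.
  rewrite /entry nV nW; have [->|//] := eqVneq d c.
  case: (leqP r s) => [le|lt]; last by rewrite nth_take.
  rewrite nth_default; last by rewrite size_take -/(height U c) hr ltnSn.
  move: le; rewrite leq_eqVlt => /predU1P[<-|lt]; first exact/esym/holed_none.
  by rewrite nth_default // -/(height U c) hr.
split; last exact: eq_skew_incidence.
split=> //.
- by move=> d; rewrite /height !nV; apply: dW.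
- by move=> d; rewrite hV; case: eqP => [->|].
- move=> d s; rewrite eV h5 hV xpair_eqE; have [->|] := eqVneq d c; last by rewrite andbT.
  by rewrite hr /=; congr andb; lia.
- by move=> d s x d' s' y; rewrite !eV; apply: h6.
by rewrite /V; elim: (set_nth _ _ _ _) => //= -[|? ?] ? IH.
Qed.

End Moves.

(** * Rectification *)

Lemma inner_boxE eta U c r : skew eta U -> inner_box U c r = (r < eta c).
Proof.
move=> sU; rewrite /inner_box -/(height U c); have := skew_le sU c.
have -> : entry U c r == None = ~~ (eta c <= r < height U c).
  by rewrite -(skew_some sU); case: (entry U c r).
by lia.
Qed.

Lemma inside_corner_holed eta U c r : skew eta U -> inside_corner U c r ->
  eta c = r.+1 /\ holed (fun d => if d == c then r else eta d) U c r.
Proof.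
move=> sU; have [h1 h2 h3 h5 h6 _] := sU.
rewrite /inside_corner !(inner_boxE _ _ sU) -!leqNgt => /and3P[ltr le1 le2].
have lt : r < height U c by apply: leq_trans (h3 c).
have er : eta c = r.+1 by apply/eqP; rewrite eqn_leq le1 ltr.
split=> //; split=> //.
- move=> d; have [e|n1] := eqVneq d.+1 c.
    have -> : (d == c) = false by lia.
    by have := h1 d; rewrite e er; apply: ltnW.
  by have [->|n2] := eqVneq d c; [apply: le2|apply: h1].
- move=> d; case: eqP => [->|_]; last exact: h3.
  exact: ltnW.
- by rewrite eqxx leqnn.
move=> d s; rewrite h5 xpair_eqE; have [->|] := eqVneq d c; last by rewrite andbT.
by rewrite er /=; lia.
Qed.

(** The hole moves right or down inside a bounded region. *)
Lemma slide_exists eta U c r : holed eta U c r -> exists V, slide c r U V.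
Proof.
have [n] := ubnP (size U + height U 0 - (c + r)).
elim: n U c r => // n IH U c r ltn hU.
have hmax d s x : entry U d s = Some x -> d + s < size U + height U 0.
  move=> e; have lt := entry_lt e.
  have := decreasing_leq (holed_height hU) (leq0n d).
  by have := @height_gt0 U d (leq_ltn_trans (leq0n s) lt); lia.
have down b : entry U c r.+1 = Some b ->
    (forall a, entry U c.+1 r = Some a -> b <= a) -> exists V, slide c r U V.
  move=> eb ha; have [hM _] := holed_down hU eb ha.
  have [|V hV] := IH _ _ _ _ hM; last by exists V; apply: slide_down eb ha hV.
  rewrite (size_move hU) ?(entry_lt eb) // (height_move hU) ?(entry_lt eb) //.
  by have := hmax _ _ _ eb; lia.
have right a : entry U c.+1 r = Some a ->
    (forall b, entry U c r.+1 = Some b -> a < b) -> exists V, slide c r U V.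
  move=> ea hb; have [hM _ _] := holed_right hU ea hb.
  have [|V hV] := IH _ _ _ _ hM; last by exists V; apply: slide_right ea hb hV.
  rewrite (size_move hU) ?(entry_lt ea) // (height_move hU) ?(entry_lt ea) //.
  by have := hmax _ _ _ ea; lia.
case eb: (entry U c r.+1) => [b|]; case ea: (entry U c.+1 r) => [a|].
- have [le|lt] := leqP b a; first by apply: (down b) => // a'; rewrite ea => -[<-].
  by apply: (right a) => // b'; rewrite eb => -[<-].
- by apply: (down b) => // a'; rewrite ea.
- by apply: (right a) => // b'; rewrite eb.
by eexists; apply: slide_stop.
Qed.

Lemma slide_linked K eta U V c r : slide c r U V -> holed eta U c r -> size U <= K ->
  [/\ skew eta V, size V <= K & linked K (skew_incidence U) (skew_incidence V)].
Proof.
elim=> {c r U V} [c r U eb ea|c r U V b eb ha _ IH|c r U V a ea hb _ IH] hU leK.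
- have [sV ->] := holed_stop hU eb ea; split=> //; last exact: linked_refl.
  apply: leq_trans leK; rewrite size_filter (leq_trans (count_size _ _)) // size_set_nth.
  have [_ _ _ /andP[_ lt] _ _] := hU.
  by rewrite (maxn_idPr _) // height_gt0 // (leq_ltn_trans _ lt).
- have [hM eM] := holed_down hU eb ha.
  by rewrite -eM; apply: IH hM _; rewrite (size_move hU) ?(entry_lt eb).
have [hM hc eM] := holed_right hU ea hb.
have [|sV leV lk] := IH hM; first by rewrite (size_move hU) ?(entry_lt ea).
split=> //; apply: linked_up hc _; last by rewrite -eM.
apply: leq_trans leK; apply: height_gt0.
exact: leq_ltn_trans (entry_lt ea).
Qed.

Lemma skew_incidence_straight T :
  skew_incidence [seq map Some C | C <- T] = incidence_of T.
Proof.
apply/funext => c; apply/funext => x; rewrite /skew_incidence /incidence_of.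
case: (ltnP c (size T)) => [lt|le]; last by rewrite !nth_default ?size_map.
by rewrite (nth_map [::]) // mem_map // => y z [].
Qed.

Lemma rectifies_linked K eta U T : rectifies_to U T -> skew eta U -> size U <= K ->
  linked K (skew_incidence U) (incidence_of T).
Proof.
move=> rUT; elim: rUT eta => {U T} [T|U V T c r cor sl _ IH] eta sU leK.
  by rewrite skew_incidence_straight; apply: linked_refl.
have [_ hU] := inside_corner_holed sU cor.
have [sV leV lk] := slide_linked sl hU leK.
exact: linked_trans lk (IH _ sV leV).
Qed.

Lemma skew0_straight U : skew (fun => 0) U ->
  U = [seq map Some C | C <- map column_entries U].
Proof.
move=> sU; rewrite -map_comp -[LHS]map_id; apply: (@eq_from_nth _ [::]).
  by rewrite !size_map.
move=> c; rewrite map_id => ltc; rewrite (nth_map [::]) //=.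
have : all isSome (nth [::] U c).
  by apply/(all_nthP None) => r ltr; have := skew_some sU c r; rewrite /entry => ->.
by elim: (nth _ _ _) => //= -[x|] //= C IH /IH {1}->.
Qed.

(** While eta is nonzero, the lowest inner box of the last column that has
    one is an inside corner; every slide removes one inner box. *)
Lemma rectification_exists K eta U : skew eta U -> (forall c, K <= c -> eta c = 0) ->
  exists2 T, rectifies_to U T & skew (fun => 0) [seq map Some C | C <- T].
Proof.
have [n] := ubnP (\sum_(c < K) eta c); elim: n eta U => // n IH eta U ltn sU eta0.
have [no|[c hc]] : (forall c, eta c = 0) \/ exists c, 0 < eta c.
  case: (pselect (exists c, 0 < eta c)) => [|no]; [by right|left=> c].
  by apply/eqP; rewrite -leqn0 leqNgt; apply/negP => gt; apply: no; exists c.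
  have e0 : eta = fun => 0 by apply/funext.
  rewrite e0 in sU; have eU := skew0_straight sU.
  exists (map column_entries U); last by rewrite -eU.
  by rewrite {1}eU; apply: rectified.
have exc : exists c, 0 < eta c by exists c.
have ubc d : 0 < eta d -> d <= K by case: (leqP d K) => // /ltnW/eta0->.
case: (ex_maxnP exc ubc) => d hd maxd.
have ltdK : d < K by rewrite ltnNge; apply/negP => /eta0 e; rewrite e in hd.
have ed1 : eta d.+1 = 0.
  by apply/eqP; rewrite -leqn0 leqNgt; apply/negP => /maxd; rewrite ltnn.
have cor : inside_corner U d (eta d).-1.
  by rewrite /inside_corner !(inner_boxE _ _ sU) ed1 ltn0 andbT prednK // ltnn leqnn.
have [er hU] := inside_corner_holed sU cor.
have [V hV] := slide_exists hU.
have [sV _ _] := slide_linked hV hU (leqnn _).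
have [||T rT sT] := IH _ V _ sV.
- suff : \sum_(c0 < K) (if c0 == d :> nat then (eta d).-1 else eta c0) < \sum_(c < K) eta c.
    by move=> lt; apply: leq_trans lt _; rewrite -ltnS.
  rewrite (bigD1 (Ordinal ltdK)) //= [X in _ < X](bigD1 (Ordinal ltdK)) //=.
  rewrite eqxx -addSn prednK //.
  by rewrite leq_add2l; apply: leq_sum => i; rewrite -val_eqE /= => /negbTE->.
- move=> e leK /=; have [ed|_] := eqVneq e d; last exact: eta0.
  by rewrite ed leqNgt ltdK in leK.
by exists T => //; apply: rectify_slide cor hV rT.
Qed.

Lemma is_shape_decreasing zeta : is_shape zeta -> decreasing (nth 0 zeta).
Proof.
move=> /andP[_ srt] c; have [lt|le] := ltnP c.+1 (size zeta); last by rewrite nth_default.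
exact: (sortedP 0 srt).
Qed.

Lemma is_skew_tableau_skew zeta eta U : is_skew_tableau zeta eta U -> skew (nth 0 eta) U.
Proof.
move=> [[sz se le] sizes some _ [down right]].
have hz c : height U c = nth 0 zeta c.
  rewrite -sizes /height; have [lt|ge] := ltnP c (size U); first by rewrite (nth_map [::]).
  by rewrite !nth_default ?size_map.
have dz := is_shape_decreasing sz; have de := is_shape_decreasing se.
have vert c r k x y : entry U c r = Some x -> entry U c (r + k) = Some y ->
    x <= y /\ (0 < k -> x < y).
  elim: k y => [|k IH] y ex; first by rewrite addn0 ex => -[<-].
  rewrite addnS => ey; have : isSome (entry U c (r + k)).
    have := some c r; have := some c (r + k).+1; rewrite ex ey some /=; lia.
  case ez: (entry U c (r + k)) => [z|] // _.
  by have [le1 _] := IH _ ex ez; have := down _ _ _ _ ez ey; split; lia.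
have horz c r k x y : entry U c r = Some x -> entry U (c + k) r = Some y -> x <= y.
  elim: k y => [|k IH] y ex; first by rewrite addn0 ex => -[<-].
  rewrite addnS => ey; have : isSome (entry U (c + k) r).
    have := some c r; have := some (c + k).+1 r; rewrite ex ey some /=.
    have := decreasing_leq de (leq_addr k c); have := dz (c + k); lia.
  case ez: (entry U (c + k) r) => [z|] // _.
  exact: leq_trans (IH _ ex ez) (right _ _ _ _ ez ey).
split=> //.
- by move=> c; rewrite !hz.
- by move=> c; rewrite hz.
- by move=> c r; rewrite some hz.
- move=> c r x c' r' y ex ey lec ler.
  have : isSome (entry U c r').
    have := some c r; have := some c' r'; rewrite ex ey some /=.
    have := decreasing_leq dz lec; lia.
  case ez: (entry U c r') => [z|] // _.
  have := ez; rewrite -(subnKC ler) => /(vert _ _ _ _ _ ex)[le1 lt1].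
  have := ey; rewrite -(subnKC lec) => /(horz _ _ _ _ _ ez) le2.
  by split; lia.
have /andP[pos _] := sz.
by move: pos; rewrite -sizes all_map; apply: sub_all => -[].
Qed.

(** * Staircases of columns *)

Definition total (Ds : seq (seq nat)) : nat := sumn (map size Ds).

(** Every column ends just above the row in which the column on its left
    begins, so that no row meets two columns. *)
Fixpoint staircase (Ds : seq (seq nat)) : seq (seq (option nat)) :=
  if Ds is D :: Ds' then (nseq (total Ds') None ++ map Some D) :: staircase Ds' else [::].

Lemma nth_staircase Ds c : nth [::] (staircase Ds) c =
  nseq (total (drop c.+1 Ds)) None ++ map Some (nth [::] Ds c).
Proof.
by elim: Ds c => [|D Ds IH] [|c] //=; rewrite ?drop0 ?IH.
Qed.

Lemma size_nth_staircase Ds c : size (nth [::] (staircase Ds) c) = total (drop c Ds).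
Proof.
rewrite nth_staircase size_cat size_nseq size_map addnC.
elim: Ds c => [|D Ds IH] [|c] //=; first by rewrite drop0.
Qed.

Lemma size_staircase Ds : size (staircase Ds) = size Ds.
Proof. by elim: Ds => //= D Ds ->. Qed.

Lemma entry_staircase Ds c r : entry (staircase Ds) c r =
  if r < total (drop c.+1 Ds) then None
  else nth None (map Some (nth [::] Ds c)) (r - total (drop c.+1 Ds)).
Proof.
rewrite /entry nth_staircase nth_cat size_nseq; case: ifP => // lt.
by rewrite nth_nseq if_same.
Qed.

Lemma staircase_skew_tableau Ds : all (fun D => D != [::]) Ds -> all (sorted ltn) Ds ->
  all (all (leq 1)) Ds ->
  exists zeta eta, is_skew_tableau zeta eta (staircase Ds).
Proof.
move=> ne srt pos; pose zeta := map size (staircase Ds).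
have nz c : nth 0 zeta c = total (drop c Ds).
  have [lt|le] := ltnP c (size (staircase Ds)).
    by rewrite (nth_map [::]) // size_nth_staircase.
  by rewrite nth_default ?size_map // drop_oversize // -size_staircase.
have ne1 c : nth 0 (behead zeta) c = total (drop c.+1 Ds) by rewrite nth_behead nz.
have tot c : total (drop c Ds) = size (nth [::] Ds c) + total (drop c.+1 Ds).
  by rewrite -size_nth_staircase nth_staircase size_cat size_nseq size_map addnC.
have sh : is_shape zeta.
  apply/andP; split.
    apply/(all_nthP 0) => c; rewrite size_map size_staircase => lt.
    rewrite nz tot; have := all_nthP [::] ne c lt; rewrite -size_eq0; lia.
  by apply/(sortedP 0) => c _; rewrite /= !nz [X in _ <= X]tot leq_addl.
have col c : sorted ltn (nth [::] Ds c).
  by have [lt|le] := ltnP c (size Ds); [apply: all_nthP|rewrite nth_default].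
have val c r x : entry (staircase Ds) c r = Some x ->
    [/\ total (drop c.+1 Ds) <= r, r - total (drop c.+1 Ds) < size (nth [::] Ds c) &
        x = nth 0 (nth [::] Ds c) (r - total (drop c.+1 Ds))].
  rewrite entry_staircase; case: ltnP => // le.
  have [lt|ge] := ltnP (r - total (drop c.+1 Ds)) (size (nth [::] Ds c)).
    by rewrite (nth_map 0) // => -[<-].
  by rewrite nth_default ?size_map.
exists zeta, (behead zeta); split=> //.
- split=> //.
    move: sh; rewrite /is_shape; case: zeta {nz ne1} => //= z s.
    by case/andP=> /andP[_ ->] /path_sorted.
  by move=> c; rewrite ne1 nz [X in _ <= X]tot leq_addl.
- move=> c r; rewrite entry_staircase ne1 nz (tot c); move: (total _) => t.
  case: (ltnP r t) => //= le; have [lt|ge] := ltnP (r - t) (size (nth [::] Ds c)).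
    by rewrite (nth_map 0) // addnC -ltn_subLR // lt.
  by rewrite nth_default ?size_map // addnC -ltn_subLR // ltnNge ge.
- move=> c r x /val[le lt ->].
  have [ltc|ge] := ltnP c (size Ds); last by move: lt; rewrite nth_default.
  by apply: (all_nthP 0 (all_nthP [::] pos c ltc)).
split=> c r x y /val[le lt ->] /val[le' lt' ->].
  by rewrite subSn // in lt' *; apply: (sortedP 0 (col c)).
by have := tot c.+1; lia.
Qed.

Lemma staircase_incidence Ds : skew_incidence (staircase Ds) = incidence_of Ds.
Proof.
apply/funext => c; apply/funext => x; rewrite /skew_incidence /incidence_of nth_staircase.
by rewrite mem_cat mem_nseq andbF /= mem_map // => y z [].
Qed.

Lemma column_entries_staircase Ds :
  [seq column_entries C | C <- staircase Ds] = Ds.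
Proof.
elim: Ds => //= D Ds ->; congr (_ :: _).
rewrite /column_entries pmap_cat.
have -> : pmap id (nseq (total Ds) (@None nat)) = [::] by elim: (total Ds).
exact: (@map_pK _ _ id Some).
Qed.

Lemma column_lengths_entries U : column_lengths U = [seq size (column_entries C) | C <- U].
Proof. by apply: eq_map => C; rewrite size_pmap. Qed.

Local Notation nonempty := (fun C : seq nat => C != [::]).

(** * The right key *)

Lemma column_le_nth Ds c : sorted column_le Ds -> column_le (nth [::] Ds c) (nth [::] Ds c.+1).
Proof.
move=> srt; have [lt|le] := ltnP c.+1 (size Ds); first exact: (sortedP [::] srt).
by rewrite [nth _ _ c.+1]nth_default //; apply/column_leP.
Qed.

Lemma sorted_nth Ds c : all (sorted ltn) Ds -> sorted ltn (nth [::] Ds c).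
Proof.
by move=> srt; have [lt|le] := ltnP c (size Ds); [apply: all_nthP | rewrite nth_default].
Qed.

Lemma incidence_col_highest Ds : all (sorted ltn) Ds -> sorted column_le Ds ->
  col_highest (incidence_of Ds).
Proof.
move=> srt col c p [/(_ 0 (leq0n p)) + _]; rewrite addn0 ltnNge => /negP; apply.
exact: (column_le_dominates (sorted_nth c srt) (sorted_nth c.+1 srt) (column_le_nth c col) p.+1).
Qed.

Lemma incidence_supported Ds : exists N, supported (size Ds) N (incidence_of Ds).
Proof.
have [N /allP bN] := bounded_seq (flatten Ds); exists N => c x xc.
have ltc : c < size Ds.
  by rewrite ltnNge; apply/negP => le; move: xc; rewrite /incidence_of nth_default.
by split=> //; apply: bN; apply/flattenP; exists (nth [::] Ds c) => //; apply: mem_nth.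
Qed.

Lemma incidence_sizes K N Ds : all (sorted ltn) Ds -> size Ds = K ->
  supported K N (incidence_of Ds) -> col_sizes K N (incidence_of Ds) = map size Ds.
Proof.
move=> srt eK sup; apply: (@eq_from_nth _ 0); rewrite !size_map size_iota // => c ltc.
rewrite (nth_map 0) ?size_iota // nth_iota // (nth_map [::]) ?eK // below_mem_size //.
  exact/sorted_ltn_uniq/sorted_nth.
by apply/allP => x /sup[].
Qed.

Lemma incidence_inj Ds Es : all nonempty Ds -> all nonempty Es ->
  all (sorted ltn) Ds -> all (sorted ltn) Es ->
  incidence_of Ds = incidence_of Es -> Ds = Es.
Proof.
move=> nD nE sD sE eqI.
have eqn c : nth [::] Ds c = nth [::] Es c.
  apply: (irr_sorted_eq ltn_trans ltnn); [exact: sorted_nth | exact: sorted_nth |].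
  by move=> x; have := congr1 (fun M => M c x) eqI.
have le Fs Gs : all nonempty Fs -> (forall c, nth [::] Fs c = nth [::] Gs c) ->
    size Fs <= size Gs.
  move=> nF e; rewrite leqNgt; apply/negP => lt.
  by have := all_nthP [::] nF _ lt; rewrite e nth_default.
apply: (@eq_from_nth _ [::]) => // ; apply/eqP; rewrite eqn_leq !le //.
Qed.

Lemma skew_straight_tableau T : skew (fun => 0) [seq map Some C | C <- T] ->
  [/\ all nonempty T, all (sorted ltn) T & sorted column_le T].
Proof.
move=> sT; have eT : [seq column_entries C | C <- [seq map Some C | C <- T]] = T.
  by rewrite -map_comp -[RHS]map_id; apply: eq_map => C; apply: (@map_pK _ _ id Some).
have en c r : r < size (nth [::] T c) ->
    entry [seq map Some C | C <- T] c r = Some (nth 0 (nth [::] T c) r).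
  move=> lt; rewrite /entry; have ltc : c < size T.
    by rewrite ltnNge; apply/negP => le; move: lt; rewrite nth_default.
  by rewrite (nth_map [::]) // (nth_map 0).
split.
- by move: (skew_nonempty sT); rewrite all_map; apply: sub_all => -[].
- apply/(all_nthP [::]) => c ltc; rewrite -[T in nth _ T]eT (nth_map [::]) ?size_map //.
  exact/ordered_column/skew_ordered/sT.
apply/(sortedP [::]) => c ltc; have lec : size (nth [::] T c.+1) <= size (nth [::] T c).
  by have := skew_height sT c; rewrite /height !(nth_map [::]) ?size_map // ltnW.
apply/column_leP; split=> // r ltr.
have [] // := skew_ordered sT (en c r (leq_trans ltr lec)) (en c.+1 r ltr).
Qed.

Lemma skew_incidence_entries U :
  skew_incidence U = incidence_of (map column_entries U).
Proof.
apply/funext => c; apply/funext => x; rewrite /skew_incidence /incidence_of.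
have [lt|le] := ltnP c (size U); last by rewrite !nth_default ?size_map.
by rewrite (nth_map [::]) // mem_pmap map_id.
Qed.

Section Tableau.

Variables (zeta : seq nat) (T : seq (seq nat)).
Hypothesis hT : is_tableau zeta T.

Lemma tableau_facts : [/\ all nonempty T, all (sorted ltn) T & sorted column_le T].
Proof.
have srt := tableau_sorted_column_le hT; case: hT => /andP[pos _] sz _ cols _; split=> //.
by move: pos; rewrite -sz all_map; apply: sub_all => -[].
Qed.

Lemma frank_linked U : frank_rectifies_to U T ->
  let Ds := map column_entries U in
  [/\ perm_eq (map size Ds) (map size T), all (sorted ltn) Ds &
      linked (size T) (incidence_of T) (incidence_of Ds)].
Proof.
move=> [[xi [eta /is_skew_tableau_skew sU]] rU perm] Ds.
have eqs : column_lengths U = map size Ds by rewrite column_lengths_entries /Ds -map_comp.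
rewrite -eqs; split=> //.
  apply/(all_nthP [::]) => c; rewrite size_map => ltc; rewrite (nth_map [::]) //.
  exact/ordered_column/skew_ordered/sU.
rewrite -skew_incidence_entries; apply: linked_sym; apply: rectifies_linked rU sU _.
by have := perm_size perm; rewrite !size_map => ->.
Qed.

Lemma frank_last_unique U V : frank_rectifies_to U T -> frank_rectifies_to V T ->
  size (column_entries (last [::] U)) = size (column_entries (last [::] V)) ->
  column_entries (last [::] U) = column_entries (last [::] V).
Proof.
have [neT sT cT] := tableau_facts.
move=> /frank_linked; set Ds := map _ U => -[pD sD lD].
move=> /frank_linked; set Es := map _ V => -[pE sE lE].
have -> : column_entries (last [::] U) = last [::] Ds.
  by rewrite /Ds; case: (U) => //= C s; rewrite last_map.
have -> : column_entries (last [::] V) = last [::] Es.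
  by rewrite /Es; case: (V) => //= C s; rewrite last_map.
have szD : size Ds = size T by have := perm_size pD; rewrite !size_map.
have szE : size Es = size T by have := perm_size pE; rewrite !size_map.
rewrite -!nth_last szD szE; have [N supT] := incidence_supported T.
have supD := linked_supported lD supT; have supE := linked_supported lE supT.
case eK: (size T) => [|k].
  by rewrite !nth_default ?szD ?szE ?eK.
rewrite /= => eqk.
apply: (irr_sorted_eq ltn_trans ltnn); [exact: sorted_nth | exact: sorted_nth |].
suff e : incidence_of Ds k = incidence_of Es k by move=> x; have := congr1 (fun p => p x) e.
have col_size Fs : all (sorted ltn) Fs -> supported (size T) N (incidence_of Fs) ->
    below (incidence_of Fs k) N = size (nth [::] Fs k).
  move=> sF supF; apply: below_mem_size; first exact/sorted_ltn_uniq/sorted_nth.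
  by apply/allP => x /supF[].
have sz Fs : all (sorted ltn) Fs -> size Fs = size T ->
    supported (size T) N (incidence_of Fs) ->
    col_sizes (size T) N (incidence_of Fs) = map size Fs by exact: incidence_sizes.
rewrite eK in sz col_size supT supD supE lD lE.
apply: (extremal_last_col supT (incidence_col_highest sT cT) lD lE).
- by rewrite !sz // ?szD ?eK.
- by rewrite !sz // ?szE ?eK.
by rewrite !col_size.
Qed.

(** The witness is the staircase of the columns obtained from T by pushing
    column i to the far right. *)
Lemma scan_frank_right_column i : i < size T ->
  frank_right_column T (size (nth [::] T i)) (scan_col (drop i T)).
Proof.
move=> lti; have [neT sT cT] := tableau_facts.
have [_ _ posT _ _] := hT.
pose A := nth [::] T i; pose Cs := drop i.+1 T.
have eT : T = take i T ++ A :: Cs by rewrite -drop_nth // cat_take_drop.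
have [neP neA neC] : [/\ all nonempty (take i T), A != [::] & all nonempty Cs].
  by move: neT; rewrite {1}eT all_cat /= => /and3P[].
have [sP sA sC] : [/\ all (sorted ltn) (take i T), sorted ltn A & all (sorted ltn) Cs].
  by move: sT; rewrite {1}eT all_cat /= => /and3P[].
have [pP pA pC] : [/\ all (all (leq 1)) (take i T), all (leq 1) A & all (all (leq 1)) Cs].
  by move: posT; rewrite {1}eT all_cat /= => /and3P[].
have cC : path column_le A Cs.
  by have := drop_sorted i cT; rewrite (drop_nth [::]).
have domA : dominates A A by [].
have [szB sB lastB posB] := push_right_props sA sA sC domA cC.
pose Ds := take i T ++ push_right A Cs.
have pD : perm_eq (map size Ds) (map size T).
  by rewrite [X in perm_eq _ (map _ X)]eT /Ds !map_cat szB perm_cat2l /= perm_rcons.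
have szD : size Ds = size T by have := perm_size pD; rewrite !size_map.
have sD : all (sorted ltn) Ds by rewrite all_cat sP sB.
have neD : all nonempty Ds.
  have neB : all (leq 1) (map size T) by rewrite all_map; apply: sub_all neT => -[].
  by move: neB; rewrite -(perm_all _ pD) all_map; apply: sub_all => -[].
have lk : linked (size T) (incidence_of Ds) (incidence_of T).
  rewrite [X in linked _ _ (incidence_of X)]eT; apply: (linked_push_right sA sA sC domA cC).
  by rewrite size_takel ?(ltnW lti) // size_drop -addSn subnKC.
have poD : all (all (leq 1)) Ds by rewrite all_cat pP posB.
have [xi [eta hU]] := staircase_skew_tableau neD sD poD.
have sU := is_skew_tableau_skew hU.
have [|T' rT' sT'] := @rectification_exists (size eta) _ _ sU.
  by move=> c le; rewrite nth_default.
have [neT' srT' cT'] := skew_straight_tableau sT'.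
have szU : size (staircase Ds) <= size T by rewrite size_staircase szD.
have lk' := rectifies_linked rT' sU szU.
rewrite staircase_incidence in lk'.
have [N supT] := incidence_supported T.
have eqI : incidence_of T = incidence_of T'.
  apply: (col_highest_linked_eq supT (incidence_col_highest sT cT)
    (incidence_col_highest srT' cT') (linked_trans (linked_sym lk) lk')).
have eqT := incidence_inj neT neT' sT srT' eqI.
have ce : [seq column_entries C | C <- staircase Ds] = Ds := column_entries_staircase Ds.
have lastU : column_entries (last [::] (staircase Ds)) = scan_col (drop i T).
  have -> : column_entries (last [::] (staircase Ds)) = last [::] Ds.
    by rewrite -{2}ce; case: (staircase Ds) => //= C s; rewrite last_map.
  rewrite (drop_nth [::]) // scan_col_foldl //=; last by rewrite neA.
  by rewrite /Ds last_cat -lastB; case: (push_right A Cs) szB => //; case: (Cs).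
split.
  rewrite (drop_nth [::]) // scan_col_foldl //=; last by rewrite neA.
  exact: size_foldl_swap_right.
exists (staircase Ds) => //; split; first by exists xi, eta.
  by rewrite [X in rectifies_to _ X]eqT.
by rewrite column_lengths_entries map_comp ce.
Qed.

End Tableau.

Theorem theorem2p5p5 (zeta : seq nat) (T : seq (seq nat))
  (hT : is_tableau zeta T) : right_key T = scanning T.
Proof.
apply: (@eq_from_nth _ [::]); rewrite size_map ?size_scanning // => i lti.
rewrite (nth_map [::]) // nth_scanning.
have [sz [U frU lastU]] := scan_frank_right_column hT lti.
apply: xget_unique.
  move=> D; split=> [[szD [V frV lastV]]|->]; last by split=> //; exists U.
  rewrite -lastU -lastV; apply: (frank_last_unique hT) => //.
  by rewrite lastU lastV szD sz.
move=> D /(_ (scan_col (drop i T)))[eqD _]; apply/esym/eqD; split=> //.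
by exists U.
Qed.
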